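(* Let $(M,g)$ be a Riemannian manifold and let $T^1_1(M)$ be its $(1,1)$-tensor bundle with the rescaled Sasaki type metric ${}^Sg_f$. Let $r$ be the scalar curvature of $g$ and $\widetilde r$ the scalar curvature of ${}^Sg_f$. Then, at the point with coordinates $(x^j,t_j^i)$, $$\widetilde r=\tfrac1f r-\tfrac1{4f^2}g^{ab}g^{hk}g^{lj}g^{vr}R_{slhv}R_{pjkr}t_a^st_b^p-\tfrac1{4f^2}g_{cd}g^{lj}g^{hk}g^{rv}R_{rlh}{}^{s}R_{vjk}{}^{p}t_s^ct_p^d+\tfrac1{2f^2}R_{cpr}{}^{h}R_{h}{}^{r\,b\,s}t_s^ct_b^p+{}^fL,$$ where $${}^fL=\tfrac1f g^{lj}\Big(\nabla_r\big(\tfrac1{2f}{}^fA_{lj}^r\big)-\nabla_l\big(\tfrac1{2f}{}^fA_{rj}^r\big)+\tfrac1{4f^2}{}^fA_{rs}^r\,{}^fA_{lj}^s-\tfrac1{4f^2}{}^fA_{ls}^r\,{}^fA_{rj}^s\Big).$$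
   Context: All objects are smooth; Einstein summation. $f>0$ is a smooth function on $M$. $\nabla$ is the Levi-Civita connection of $g$ with Christoffel symbols $\Gamma_{ij}^h$; $R(X,Y)=[\nabla_X,\nabla_Y]-\nabla_{[X,Y]}$, $R(\partial_k,\partial_l)\partial_j=R_{klj}{}^{s}\partial_s$, $R_{kljm}=g_{ms}R_{klj}{}^s$, $R_{h}{}^{r\,b\,s}=g^{re}g^{bz}R_{hez}{}^s$; Ricci tensor $R_{lj}=R_{rlj}{}^r$, scalar curvature $r=g^{lj}R_{lj}$ (the letter $r$ is also used as an index), and likewise for ${}^Sg_f$. ${}^fA_{ji}^h=f_j\delta_i^h+f_i\delta_j^h-f^hg_{ji}$ with $f_i=\partial_if$, $f^h=g^{hm}f_m$. $T^1_1(M)$ is the bundle of $(1,1)$-tensors, with induced local coordinates $(x^j,t_j^i)$, a point being $t=t_j^i\,\partial_i\otimes dx^j$ at $x$. The vertical lift of a $(1,1)$-tensor field $A$ is ${}^VA=A_j^i\,\partial/\partial t_j^i$; the horizontal lift of a vector field $X$ is ${}^HX=X^j\partial/\partial x^j+X^s(\Gamma_{sj}^mt_m^i-\Gamma_{sm}^it_j^m)\,\partial/\partial t_j^i$. The metric is ${}^Sg_f({}^VA,{}^VB)=g_{ic}g^{jl}A_j^iB_l^c$, ${}^Sg_f({}^VA,{}^HY)=0$, ${}^Sg_f({}^HX,{}^HY)=f\,g(X,Y)$. *)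

(* Defs.v *)
From HB Require Import structures.
From mathcomp Require Import all_boot all_order all_algebra.
From mathcomp Require Import all_classical all_reals all_analysis.

Set Implicit Arguments.
Unset Strict Implicit.
Unset Printing Implicit Defensive.

Import Order.TTheory GRing.Theory Num.Theory.
Import numFieldNormedType.Exports.

Local Open Scope classical_set_scope.
Local Open Scope ring_scope.

Section Calculus.
Variables (R : realType) (n : nat).
Implicit Types (D : set 'rV[R]_n) (F : 'rV[R]_n -> R) (x : 'rV[R]_n).

Definition partial (i : 'I_n) F : 'rV[R]_n -> R :=
  fun x => 'D_(delta_mx 0 i) F x.

Fixpoint Ck (k : nat) D F : Prop :=
  {in D, continuous F} /\
  (if k is k'.+1 then
     forall i, (forall x, D x -> derivable F x (delta_mx 0 i)) /\
               Ck k' D (partial i F)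
   else True).

(* Meant for open D. *)
Definition smooth_on D F : Prop := forall k, Ck k D F.

Definition smooth_mx_on (p q : nat) D (A : 'rV[R]_n -> 'M[R]_(p, q)) : Prop :=
  forall i j, smooth_on D (fun x => A x i j).

Definition jacobian (m : nat) (A : 'rV[R]_n -> 'rV[R]_m) x : 'M[R]_(m, n) :=
  \matrix_(i, j) partial j (fun y => A y 0 i) x.

End Calculus.

(* The charts form an arbitrary smooth atlas; param u is the inverse of
   coords u on chart_img u, and its values elsewhere are irrelevant. *)
Record smoothManifold (R : realType) (n : nat) := SmoothManifold {
  carrier :> topologicalType;
  chart : Type;
  chart_dom : chart -> set carrier;
  coords : chart -> carrier -> 'rV[R]_n;
  param : chart -> 'rV[R]_n -> carrier;
  chart_img := fun u => coords u @` chart_dom u;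
  manifold_hausdorff : hausdorff_space carrier;
  manifold_second_countable : @second_countable carrier;
  chart_cover : forall p, exists u, chart_dom u p;
  open_chart_dom : forall u, open (chart_dom u);
  open_chart_img : forall u, open (chart_img u);
  coordsK : forall u p, chart_dom u p -> param u (coords u p) = p;
  coords_continuous : forall u, {in chart_dom u, continuous (coords u)};
  param_continuous : forall u, {in chart_img u, continuous (param u)};
  transition_smooth : forall u v,
    smooth_mx_on (coords u @` (chart_dom u `&` chart_dom v))
                 (fun x => coords v (param u x))
}.

Section Manifold.
Variables (R : realType) (n : nat) (M : smoothManifold R n).

Definition local_rep (u : chart M) (f : M -> R) : 'rV[R]_n -> R :=
  fun x => f (param u x).

Definition smooth_function (f : M -> R) : Prop :=
  forall u, smooth_on (chart_img u) (local_rep u f).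

(* D(v o u^-1) at the point p. *)
Definition transition_jacobian (u v : chart M) (p : M) : 'M[R]_n :=
  jacobian (fun x => coords v (param u x)) (coords u p).

(* A Riemannian metric, given by its component matrices (g_ij) in all charts. *)
Record riemannianMetric := RiemannianMetric {
  metric_comp :> chart M -> 'rV[R]_n -> 'M[R]_n;
  metric_comp_smooth : forall u, smooth_mx_on (chart_img u) (metric_comp u);
  metric_comp_sym : forall u x, chart_img u x ->
    (metric_comp u x)^T = metric_comp u x;
  metric_comp_pos : forall u x, chart_img u x ->
    forall X : 'rV[R]_n, X != 0 -> 0 < (X *m metric_comp u x *m X^T) 0 0;
  metric_comp_transform : forall u v p, chart_dom u p -> chart_dom v p ->
    metric_comp u (coords u p) =
    (transition_jacobian u v p)^T *m metric_comp v (coords v p)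
      *m transition_jacobian u v p
}.

(* The total space of T^1_1(M): a point p of M with a (1,1)-tensor on T_pM, the
   latter given by its components in all charts around p (and the dummy value
   0 in the others).  The upper index is the row index: tcomp e u i j = t_j^i. *)
Record tensor11 := Tensor11 {
  tbase : M;
  tcomp : chart M -> 'M[R]_n;
  tcomp_transform : forall u v, chart_dom u tbase -> chart_dom v tbase ->
    tcomp v = transition_jacobian u v tbase *m tcomp u
                *m transition_jacobian v u tbase;
  tcomp_dummy : forall u, ~ chart_dom u tbase -> tcomp u = 0
}.

End Manifold.

(* Tensor calculus of a metric with component matrix g on a coordinate domain
   of R^n. Upper indices come last. *)
Section LeviCivita.
Variables (R : realType) (n : nat) (g : 'rV[R]_n -> 'M[R]_n).
Implicit Types (i j h k l s : 'I_n) (X Y Z : 'rV[R]_n -> 'rV[R]_n).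

Definition ginv (x : 'rV[R]_n) : 'M[R]_n := invmx (g x).

Definition christoffel i j h (x : 'rV[R]_n) : R :=
  2^-1 * \sum_m ginv x h m *
    (partial i (fun y => g y j m) x + partial j (fun y => g y i m) x
     - partial m (fun y => g y i j) x).

Definition nabla X Y : 'rV[R]_n -> 'rV[R]_n := fun x =>
  \row_h \sum_i X x 0 i *
    (partial i (fun y => Y y 0 h) x + \sum_j christoffel i j h x * Y x 0 j).

Definition bracket X Y : 'rV[R]_n -> 'rV[R]_n := fun x =>
  \row_h \sum_i (X x 0 i * partial i (fun y => Y y 0 h) x
                 - Y x 0 i * partial i (fun y => X y 0 h) x).

Definition curvature X Y Z : 'rV[R]_n -> 'rV[R]_n := fun x =>
  nabla X (nabla Y Z) x - nabla Y (nabla X Z) x - nabla (bracket X Y) Z x.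

Definition coord_field k : 'rV[R]_n -> 'rV[R]_n := fun=> delta_mx 0 k.

(* R_{klj}^s *)
Definition riem k l j s (x : 'rV[R]_n) : R :=
  curvature (coord_field k) (coord_field l) (coord_field j) x 0 s.

(* R_{kljm} = g_{ms} R_{klj}^s *)
Definition riem_low k l j m (x : 'rV[R]_n) : R :=
  \sum_s g x m s * riem k l j s x.

(* R_h^{r b s} = g^{re} g^{bz} R_{hez}^s *)
Definition riem_up h r b s (x : 'rV[R]_n) : R :=
  \sum_e \sum_z ginv x r e * ginv x b z * riem h e z s x.

Definition ricci l j (x : 'rV[R]_n) : R := \sum_r riem r l j r x.

Definition scalar_curvature (x : 'rV[R]_n) : R :=
  \sum_l \sum_j ginv x l j * ricci l j x.

(* nabla_r C_{lj}^h *)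
Definition cov12 (C : 'I_n -> 'I_n -> 'I_n -> 'rV[R]_n -> R) r l j h
    (x : 'rV[R]_n) : R :=
  partial r (C l j h) x
  + \sum_s (christoffel r s h x * C l j s x
            - christoffel r l s x * C s j h x
            - christoffel r j s x * C l s h x).

Variable f : 'rV[R]_n -> R.

(* fA j i h is A_{ji}^h = f_j delta_i^h + f_i delta_j^h - f^h g_{ji} *)
Definition fA j i h (x : 'rV[R]_n) : R :=
  partial j f x * (i == h)%:R + partial i f x * (j == h)%:R
  - (\sum_m ginv x h m * partial m f x) * g x j i.

Definition half_fA j i h (x : 'rV[R]_n) : R := (2 * f x)^-1 * fA j i h x.

Definition fL (x : 'rV[R]_n) : R :=
  (f x)^-1 * \sum_l \sum_j ginv x l j *
    (\sum_r cov12 half_fA r l j r x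
     - \sum_r cov12 half_fA l r j r x
     + (4 * f x ^+ 2)^-1 * \sum_r \sum_s fA r s r x * fA l j s x
     - (4 * f x ^+ 2)^-1 * \sum_r \sum_s fA l s r x * fA r j s x).

End LeviCivita.

Section TensorBundle.
Variables (R : realType) (n : nat).
Implicit Types (t A : 'M[R]_n) (x X : 'rV[R]_n).

(* The coordinates (x^j, t_j^i), and likewise the components with respect to
   (d/dx^j, d/dt_j^i), are stored as row_mx x (mxvec t). *)
Definition bundle_coords x t : 'rV[R]_(n + n * n) := row_mx x (mxvec t).

Definition vlift A : 'rV[R]_(n + n * n) := row_mx 0 (mxvec A).

Definition hlift (g : 'rV[R]_n -> 'M[R]_n) x t X : 'rV[R]_(n + n * n) :=
  row_mx X (mxvec (\matrix_(i, j) \sum_s X 0 s *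
    \sum_m (christoffel g s j m x * t i m - christoffel g s m i x * t m j))).

Definition bilin (N : nat) (B : 'M[R]_N) (u v : 'rV[R]_N) : R :=
  (u *m B *m v^T) 0 0.

Variable M : smoothManifold R n.

Definition tensor_coords (u : chart M) (e : tensor11 M) :
    'rV[R]_(n + n * n) :=
  bundle_coords (coords u (tbase e)) (tcomp e u).

(* G is the rescaled Sasaki type metric ^S g_f, given by its component matrices
   in the charts of T^1_1(M) induced by those of M. The lifted fields are the
   smooth local ones on the chart domain, given by their components; as the
   lifts span every tangent space, these conditions determine G on the induced
   chart domains. *)
Definition rescaled_sasaki (g : riemannianMetric M) (f : M -> R)
    (G : chart M -> 'rV[R]_(n + n * n) -> 'M[R]_(n + n * n)) : Prop :=
  forall (u : chart M) (x : 'rV[R]_n) (t : 'M[R]_n), chart_img u x ->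
  let Gxt := G u (bundle_coords x t) in
  Gxt^T = Gxt /\
  forall (A B : 'rV[R]_n -> 'M[R]_n) (X Y : 'rV[R]_n -> 'rV[R]_n),
    smooth_mx_on (chart_img u) A -> smooth_mx_on (chart_img u) B ->
    smooth_mx_on (chart_img u) X -> smooth_mx_on (chart_img u) Y ->
    [/\ bilin Gxt (vlift (A x)) (vlift (B x)) =
          \sum_i \sum_c \sum_j \sum_l
            g u x i c * ginv (g u) x j l * A x i j * B x c l,
        bilin Gxt (vlift (A x)) (hlift (g u) x t (Y x)) = 0 &
        bilin Gxt (hlift (g u) x t (X x)) (hlift (g u) x t (Y x)) =
          local_rep u f x * bilin (g u x) (X x) (Y x)].

End TensorBundle.

Lemma rescaled_sasaki_exists (R : realType) (n : nat) (M : smoothManifold R n)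
  (g : riemannianMetric M) (f : M -> R) : exists G, rescaled_sasaki g f G.
Proof.
pose H u x (t : 'M[R]_n) : 'M[R]_(n, n * n) := \matrix_s mxvec
  (\matrix_(i, j) \sum_m (christoffel (g u) s j m x * t i m
                          - christoffel (g u) s m i x * t m j)).
pose F u x t : 'M[R]_(n + n * n) := block_mx 1%:M (- H u x t) 0 1%:M.
pose V u x : 'M[R]_(n * n) := \matrix_k mxvec
  (g u x *m vec_mx (delta_mx 0 k) *m ginv (g u) x).
pose D u x : 'M[R]_(n + n * n) :=
  block_mx (local_rep u f x *: g u x) 0 0 (V u x).
exists (fun u z => F u (lsubmx z) (vec_mx (rsubmx z)) *m D u (lsubmx z)
                   *m (F u (lsubmx z) (vec_mx (rsubmx z)))^T).
move=> u x t ux; rewrite /bundle_coords row_mxKl row_mxKr mxvecK ; set Gxt := (X in X^T = _).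
have gT := metric_comp_sym g ux.
have gS i j : g u x i j = g u x j i by rewrite -[in LHS]gT mxE.
have giT : (ginv (g u) x)^T = ginv (g u) x by rewrite /ginv trmx_inv gT.
have giS i j : ginv (g u) x i j = ginv (g u) x j i by rewrite -[in LHS]giT mxE.
have sumE (E : 'I_(n * n) -> R) :
    \sum_k E k = \sum_i \sum_j E (mxvec_index i j).
  rewrite pair_bigA (reindex _ (curry_mxvec_bij _ _)) /=.
  by apply: eq_bigr => -[].
have VE i j c l : V u x (mxvec_index i j) (mxvec_index c l) =
    g u x i c * ginv (g u) x j l.
  rewrite mxE mxvecE vec_mx_delta mxE (bigD1 j) //= big1 ?addr0; last first.
    move=> k /negPf kj; rewrite mxE big1 ?mul0r // => m _.
    by rewrite mxE kj andbF mulr0.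
  rewrite mxE (bigD1 i) //= big1 ?addr0 ?mxE ?eqxx ?mulr1; last first.
    by move=> k /negPf ki; rewrite mxE ki mulr0.
  by rewrite gS.
have VT : (V u x)^T = V u x.
  apply/matrixP => k k'; rewrite mxE.
  case/mxvec_indexP: k => i j; case/mxvec_indexP: k' => c l.
  by rewrite !VE gS giS.
have FV A : vlift A *m F u x t = vlift A.
  by rewrite /F mul_row_block mul0mx mulmx0 mulmx1 add0r mul0mx add0r.
have FH X : hlift (g u) x t X *m F u x t = row_mx X 0.
  rewrite /F mul_row_block !mulmx1 mulmx0 addr0; congr row_mx.
  apply/rowP => k; case/mxvec_indexP: k => i j.
  rewrite mulmxN !mxE mxvecE mxE; apply/eqP; rewrite addrC subr_eq0; apply/eqP.
  by apply: eq_bigr => s _; rewrite mxE mxvecE mxE.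
have GE U W : bilin Gxt U W =
    ((U *m F u x t) *m D u x *m (W *m F u x t)^T) 0 0.
  by rewrite /bilin /Gxt trmx_mul !mulmxA.
split.
  rewrite /Gxt !trmx_mul trmxK mulmxA; congr (_ *m _ *m _).
  by rewrite tr_block_mx VT linearZ /= gT !trmx0.
move=> A B X Y _ _ _ _; rewrite !GE !FV !FH; split.
- rewrite mul_row_block !mul0mx !mulmx0 !add0r tr_row_mx mul_row_col.
  rewrite mul0mx add0r mxE sumE.
  rewrite [RHS]exchange_big /=; apply: eq_bigr => c _.
  under [RHS]eq_bigr => i _ do rewrite exchange_big /=.
  rewrite [RHS]exchange_big /=; apply: eq_bigr => l _.
  rewrite [_^T _ _]mxE mxvecE mxE mulr_suml sumE.
  apply: eq_bigr => i _; apply: eq_bigr => j _.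
  by rewrite VE mxvecE [A x i j * _]mulrC.
- by rewrite mul_row_block !mul0mx !mulmx0 !add0r tr_row_mx trmx0 mul_row_col
     mul0mx mulmx0 addr0 mxE.
- rewrite mul_row_block !mul0mx !mulmx0 !addr0 tr_row_mx trmx0 mul_row_col.
  by rewrite mul0mx addr0 -scalemxAr -scalemxAl mxE.
Qed.

(* Main.v *)
Require Import Defs.
From HB Require Import structures.
From mathcomp Require Import all_boot all_order all_algebra ring.
From mathcomp Require Import all_classical all_reals all_analysis.
Import Order.TTheory GRing.Theory Num.Theory.
Import numFieldNormedType.Exports.
Local Open Scope classical_set_scope.
Local Open Scope ring_scope.

(** The bundle projection is a Riemannian submersion of the rescaled Sasaki
type metric onto (M, f g): horizontal lifts are orthogonal to the fibres, and
their lengths are those of (M, f g). The horizontal distribution is the one of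
the Levi-Civita connection of g, for which the fibre metric, built from g and
its inverse, is parallel; so the fibres, which are flat, are totally geodesic.
For such a submersion O'Neill's formula says that the scalar curvature upstairs
is that of (M, f g) minus one quarter of |Omega|^2, where Omega(X, Y) is the
vertical part of the bracket of the horizontal lifts of X and Y. Two
computations remain.

- The scalar curvature of f g. The Levi-Civita connections of f g and g differ
  by the tensor A/(2f), and the curvature of the sum of a connection and a
  tensor gives the terms r/f and fL (conformal_levi_civita, conformal_scalar).

- The norm of Omega. At the point t, Omega(X, Y) is minus the curvature operator
  R(X, Y) applied to the (1,1)-tensor t (hor_curvature_tensor). This operator
  acts on each of the two indices of t. The two squares and the double product
  of these actions are the three quadratic expressions in t; the symmetries of
  the curvature tensor bring them to the form of the statement
  (curvature_action_square).

O'Neill's formula is submersion_scalar_curvature. It is proved in the frame made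
of horizontal lifts and vertical coordinate fields. In that frame the metric is
block diagonal, and the Levi-Civita connection has a short expression, which is
recognized because metric compatibility and torsion determine a connection
(levi_civita_unique). Scalar curvature does not depend on the frame
(frame_scalarE).

Apart from the symmetry of second derivatives, all of this is algebra: it uses
only that smooth functions form a commutative ring on which the coordinate
fields act as commuting derivations. The computations are therefore made over an
arbitrary commutative ring with derivations, and then applied to the ring of
smooth functions on the domain of an induced chart of the bundle; evaluation at
a point gives the theorem. *)

Set Implicit Arguments.
Unset Strict Implicit.
Unset Printing Implicit Defensive.

(** * Sums and congruent matrices *)

Lemma sum_delta (B : pzSemiRingType) (I : finType) (F : I -> B) a :
  \sum_i (i == a)%:R * F i = F a.
Proof.
rewrite (bigD1 a) //= eqxx mul1r big1 ?addr0 // => i /negPf ->.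
by rewrite mul0r.
Qed.

Lemma sum_reindex (B : nmodType) (I J : finType) (p : I -> J) (q : J -> I)
    (F : I -> B) (G : J -> B) : cancel p q -> cancel q p ->
  (forall i, F i = G (p i)) -> \sum_i F i = \sum_j G j.
Proof.
move=> pK qK FG; rewrite [RHS](reindex p); first by apply: eq_bigr => i _.
by exists q => i _.
Qed.

Lemma sym_inverse (B : comNzRingType) n (g gi : 'M[B]_n) :
  g *m gi = 1%:M -> g^T = g -> gi^T = gi.
Proof.
move=> ggi gT; rewrite -[LHS]mulmx1 -ggi mulmxA -{1}gT -trmx_mul ggi trmx1.
by rewrite mul1mx.
Qed.

Section Congruence.
Variables (B : comNzRingType) (N : nat) (P Q : 'M[B]_N).
Hypotheses (PQ : P *m Q = 1%:M) (QP : Q *m P = 1%:M).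

Let PQT : Q^T *m P^T = 1%:M.
Proof. by rewrite -trmx_mul PQ trmx1. Qed.

Lemma congruenceK (A : 'M[B]_N) : P *m (Q *m A *m Q^T) *m P^T = A.
Proof. by rewrite !mulmxA PQ mul1mx -mulmxA PQT mulmx1. Qed.

Lemma congruence_inv (A Ai : 'M[B]_N) : A *m Ai = 1%:M ->
  (Q *m A *m Q^T) *m (P^T *m Ai *m P) = 1%:M.
Proof.
move=> AAi; rewrite !mulmxA -(mulmxA (Q *m A)) PQT mulmx1.
by rewrite -(mulmxA Q) AAi mulmx1.
Qed.

Lemma congruence_sym (A : 'M[B]_N) :
  A^T = A -> (Q *m A *m Q^T)^T = Q *m A *m Q^T.
Proof. by move=> AT; rewrite !trmx_mul trmxK AT mulmxA. Qed.

End Congruence.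

(** * Derivations of a commutative ring *)

Record derivation (B : comNzRingType) := Derivation {
  der_fun :> B -> B;
  der_zmod : zmod_morphism der_fun;
  derM : forall a b, der_fun (a * b) = der_fun a * b + a * der_fun b
}.
Arguments der_fun : simpl never.

HB.instance Definition _ (B : comNzRingType) (d : derivation B) :=
  GRing.isZmodMorphism.Build B B (der_fun d) (@der_zmod B d).

Section Derivations.
Variable B : comNzRingType.
Implicit Types d : derivation B.

Lemma der1 d : d 1 = 0.
Proof.
have /eqP := derM d 1 1; rewrite !mulr1 mul1r -{1}[d 1]addr0.
by rewrite (inj_eq (addrI _)) eq_sym => /eqP.
Qed.

Lemma der_nat d k : d k%:R = 0.
Proof. by rewrite raddfMn /= der1 mul0rn. Qed.

Lemma half_reg (half x : B) : half + half = 1 -> x + x = 0 -> x = 0.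
Proof. by move=> hh xx; rewrite -[x]mul1r -hh mulrDl -mulrDr xx mulr0. Qed.

Lemma der_half d (half : B) : half + half = 1 -> d half = 0.
Proof.
by move=> hh; apply: (half_reg hh); rewrite -raddfD hh /= der1.
Qed.

Lemma map_mx_derM d m n p (P : 'M[B]_(m, n)) (Q : 'M[B]_(n, p)) :
  map_mx d (P *m Q) = map_mx d P *m Q + P *m map_mx d Q.
Proof.
apply/matrixP => i j; rewrite !mxE raddf_sum -big_split /=.
by apply: eq_bigr => k _; rewrite derM !mxE.
Qed.

Lemma map_mx_derZ d m n a (P : 'M[B]_(m, n)) :
  map_mx d (a *: P) = d a *: P + a *: map_mx d P.
Proof. by apply/matrixP => i j; rewrite !mxE derM. Qed.

Lemma map_mx_der1 d n : map_mx d (1%:M : 'M[B]_n) = 0.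
Proof. by apply/matrixP => i j; rewrite !mxE der_nat. Qed.

Lemma map_mx_derV d n (P Q : 'M[B]_n) : Q *m P = 1%:M -> P *m Q = 1%:M ->
  map_mx d Q = - (Q *m map_mx d P *m Q).
Proof.
move=> QP PQ.
have /(congr1 (mulmx^~ Q)) := map_mx_derM d Q P.
rewrite QP map_mx_der1 mul0mx mulmxDl -mulmxA PQ mulmx1 => /eqP.
by rewrite eq_sym addr_eq0 => /eqP.
Qed.

Lemma sum_der_zmod (I : finType) (a : I -> B) (d : I -> derivation B) :
  zmod_morphism (fun x => \sum_i a i * d i x).
Proof.
move=> x y; rewrite -sumrB; apply: eq_bigr => i _.
by rewrite raddfB mulrBr.
Qed.

Lemma sum_derM (I : finType) (a : I -> B) (d : I -> derivation B) x y :
  \sum_i a i * d i (x * y) =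
    (\sum_i a i * d i x) * y + x * \sum_i a i * d i y.
Proof.
rewrite mulr_suml mulr_sumr -big_split /=; apply: eq_bigr => i _.
by rewrite derM; ring.
Qed.

Definition sum_der (I : finType) (a : I -> B) (d : I -> derivation B) :=
  Derivation (sum_der_zmod a d) (sum_derM a d).

End Derivations.

(** * Connections and curvature in moving frames *)

Section Frames.
Variables (B : comNzRingType) (N : nat).
Implicit Types (D : 'I_N -> derivation B) (C : 'I_N -> 'I_N -> 'rV[B]_N).
Implicit Types (w : 'I_N -> 'M[B]_N) (g : 'M[B]_N).

(** Curvature of a connection in a frame (E_a): D a is the derivation along E_a,
the brackets are [E_a, E_b] = sum_e C a b e E_e, and w a is the matrix whose row
b holds the components of nabla_(E_a) E_b. Components are row vectors, so a
second covariant derivative multiplies matrices in the reverse order, and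
nabla_(E_a) nabla_(E_b) contributes w b *m w a. *)
Definition frame_curvature D C w a b : 'M[B]_N :=
  map_mx (D a) (w b) - map_mx (D b) (w a) + w b *m w a - w a *m w b
  - \sum_e C a b 0 e *: w e.

Lemma frame_curvature0 D w a b : frame_curvature D (fun _ _ => 0) w a b =
  map_mx (D a) (w b) - map_mx (D b) (w a) + w b *m w a - w a *m w b.
Proof.
by rewrite /frame_curvature big1 ?subr0 // => e _; rewrite mxE scale0r.
Qed.

(** Compatibility with the metric g, and vanishing of the torsion in a frame with
brackets C. *)
Definition levi_civita D C g w : Prop :=
  (forall a, map_mx (D a) g = w a *m g + g *m (w a)^T) /\
  (forall a b, row b (w a) - row a (w b) = C a b).

(** The matrix K a b sends E_c to R(E_a, E_b) E_c, and the Ricci tensor is the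
trace over the first argument; gi is the inverse of the metric. *)
Definition frame_scalar (gi : 'M[B]_N) (K : 'I_N -> 'I_N -> 'M[B]_N) : B :=
  \sum_b \sum_c gi b c * \sum_a K a b c a.

(** The difference of two solutions, with its last index lowered, is symmetric in
its first two indices and antisymmetric in its last two. Three alternations of
these exchanges return to the same component with the opposite sign. *)
Lemma levi_civita_unique D C g gi w w' : (forall x : B, x + x = 0 -> x = 0) ->
  g *m gi = 1%:M -> g^T = g ->
  levi_civita D C g w -> levi_civita D C g w' -> forall a, w a = w' a.
Proof.
move=> two_reg ggi gT [cw tw] [cw' tw'].
pose S a := (w a - w' a) *m g.
have Santi a b c : S a b c = - S a c b.
  have /matrixP/(_ b c) : S a + (S a)^T = 0.
    rewrite /S trmx_mul gT linearB /= mulmxBr mulmxBl addrACA -opprD.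
    by rewrite -cw -cw' subrr.
  by rewrite !mxE => /eqP; rewrite addr_eq0 => /eqP.
have Ssym a b c : S a b c = S b a c.
  have E : row b (w a - w' a) = row a (w b - w' b).
    have := tw a b; rewrite -tw' => /eqP; rewrite subr_eq => /eqP E.
    by rewrite !linearB /= E addrAC [X in X + _]addrAC subrr sub0r addrC.
  have /rowP/(_ c) : row b (S a) = row a (S b) by rewrite /S !row_mul E.
  by rewrite !mxE.
move=> a; apply/eqP; rewrite -subr_eq0; apply/eqP.
rewrite -[LHS]mulmx1 -ggi mulmxA -/(S a).
suff -> : S a = 0 by rewrite mul0mx.
apply/matrixP => b c; rewrite [RHS]mxE; apply: two_reg.
(* One of the two copies of S a b c is brought round the cycle. *)
rewrite {1}Ssym {1}Santi {1}Ssym {1}Santi opprK {1}Ssym {1}Santi.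
by rewrite addNr.
Qed.

Variables (d : 'I_N -> derivation B).
Hypothesis dC : forall i j x, d i (d j x) = d j (d i x).
Variables (E Ei : 'M[B]_N).
Hypotheses (EEi : E *m Ei = 1%:M) (EiE : Ei *m E = 1%:M).

Let C0 : 'I_N -> 'I_N -> 'rV[B]_N := fun _ _ => 0.

Definition frame_der a : derivation B := sum_der (E a) d.

Lemma frame_derE a x : frame_der a x = \sum_p E a p * d p x.
Proof. by []. Qed.

Lemma map_mx_frame_der a m k (P : 'M[B]_(m, k)) :
  map_mx (frame_der a) P = \sum_p E a p *: map_mx (d p) P.
Proof.
apply/matrixP => i j; rewrite mxE summxE frame_derE.
by apply: eq_bigr => p _; rewrite !mxE.
Qed.

(** The bracket of the a-th and b-th rows of E, seen as vector fields, in
components with respect to these rows. *)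
Definition frame_bracket a b : 'rV[B]_N :=
  (map_mx (frame_der a) (row b E) - map_mx (frame_der b) (row a E)) *m Ei.

(** The same connection in the frame given by the rows of E: differentiate these
rows covariantly in coordinates, and expand the result in the frame. *)
Definition frame_connection w a : 'M[B]_N :=
  (map_mx (frame_der a) E + E *m \sum_p E a p *: w p) *m Ei.

Lemma frame_bracketE a b e : \sum_c frame_bracket a b 0 c * E c e =
  frame_der a (E b e) - frame_der b (E a e).
Proof.
have /rowP/(_ e) : frame_bracket a b *m E =
    map_mx (frame_der a) (row b E) - map_mx (frame_der b) (row a E).
  by rewrite -mulmxA EiE mulmx1.
by rewrite !mxE.
Qed.

(** The second derivatives cancel because the coordinate derivations commute. *)
Lemma frame_der_commutator a b x :
  frame_der a (frame_der b x) - frame_der b (frame_der a x) =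
  \sum_e frame_bracket a b 0 e * frame_der e x.
Proof.
have aux u v : frame_der u (frame_der v x) =
    \sum_e frame_der u (E v e) * d e x
    + \sum_k \sum_l E u k * E v l * d k (d l x).
  rewrite [frame_der v x]frame_derE raddf_sum /=.
  rewrite [X in _ + X]exchange_big -big_split /=; apply: eq_bigr => l _.
  rewrite derM [frame_der u (d l x)]frame_derE; congr (_ + _).
  by rewrite mulr_sumr; apply: eq_bigr => k _; ring.
have aux2 : \sum_k \sum_l E a k * E b l * d k (d l x) =
            \sum_k \sum_l E b k * E a l * d k (d l x).
  rewrite exchange_big; apply: eq_bigr => k _; apply: eq_bigr => l _ /=.
  by rewrite dC mulrC [E b k * _]mulrC mulrC.
rewrite !aux aux2 opprD addrACA subrr addr0 -sumrB.
under eq_bigr => e _ do rewrite -mulrBl -frame_bracketE mulr_suml.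
rewrite exchange_big /=; apply: eq_bigr => c _.
by rewrite mulr_sumr; apply: eq_bigr => e _; rewrite mulrA.
Qed.

Lemma frame_connectionE w a : frame_connection w a *m E =
  map_mx (frame_der a) E + E *m \sum_p E a p *: w p.
Proof. by rewrite -mulmxA EiE mulmx1. Qed.

Lemma frame_levi_civita g w : levi_civita d C0 g w ->
  levi_civita frame_der frame_bracket (E *m g *m E^T) (frame_connection w).
Proof.
move=> [cw tw]; split=> [a|a b].
  have dg : map_mx (frame_der a) g =
      (\sum_p E a p *: w p) *m g + g *m (\sum_p E a p *: w p)^T.
    rewrite linear_sum /= mulmx_suml mulmx_sumr -big_split /=.
    rewrite map_mx_frame_der; apply: eq_bigr => p _.
    by rewrite cw scalerDr scalemxAl linearZ /= scalemxAr.
  rewrite 2!map_mx_derM dg -map_trmx.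
  have := frame_connectionE w a; move: (frame_connection w a) => W WE.
  have -> : E *m g *m E^T *m W^T = E *m g *m (W *m E)^T.
    by rewrite trmx_mul !mulmxA.
  rewrite [W *m _]mulmxA [W *m _]mulmxA WE [(_ + _)^T]linearD /= trmx_mul.
  rewrite !(mulmxDr, mulmxDl, mulmxA).
  rewrite -!addrA; congr (_ + (_ + _)).
  by rewrite addrC.
rewrite -[LHS]mulmx1 -EEi mulmxA; congr (_ *m _).
rewrite mulmxBl -!row_mul !frame_connectionE !linearD /= !map_row.
rewrite addrACA [X in _ + X](_ : _ = 0) ?addr0 //.
rewrite !row_mul !mulmx_sumr.
apply/eqP; rewrite subr_eq0; apply/eqP.
have aux u v : \sum_p row u E *m (E v p *: w p) =
    \sum_p \sum_q (E v p * E u q) *: row q (w p).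
  apply: eq_bigr => p _; rewrite -scalemxAr mulmx_sum_row scaler_sumr.
  by apply: eq_bigr => q _; rewrite mxE scalerA.
rewrite !aux exchange_big /=; apply: eq_bigr => p _; apply: eq_bigr => q _.
have /eqP := tw p q; rewrite subr_eq0 => /eqP ->.
by rewrite mulrC.
Qed.

(** Tensoriality of the curvature. Multiplying on the right by E turns every
connection matrix of the frame into its defining sum; then the first derivatives
of E cancel in pairs, and the second ones against the bracket term. *)
Lemma frame_curvatureE w a b :
  frame_curvature frame_der frame_bracket (frame_connection w) a b =
  E *m (\sum_k \sum_l (E a k * E b l) *: frame_curvature d C0 w k l) *m Ei.
Proof.
rewrite -[LHS]mulmx1 -EEi mulmxA; congr (_ *m _).
set W := frame_connection w; pose O a := \sum_p E a p *: w p.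
have WE u : W u *m E = map_mx (frame_der u) E + E *m O u.
  exact: frame_connectionE.
have dWE u v : map_mx (frame_der u) (W v) *m E =
    map_mx (frame_der u) (map_mx (frame_der v) E)
    + map_mx (frame_der u) E *m O v + E *m map_mx (frame_der u) (O v)
    - W v *m map_mx (frame_der u) E.
  have /eqP := map_mx_derM (frame_der u) (W v) E.
  rewrite WE map_mxD map_mx_derM -subr_eq => /eqP <-.
  by rewrite -!addrA.
have WWE u v : W u *m W v *m E = W u *m map_mx (frame_der v) E +
    (map_mx (frame_der u) E *m O v + E *m O u *m O v).
  by rewrite -mulmxA WE mulmxDr mulmxA WE mulmxDl.
have CE : (\sum_e frame_bracket a b 0 e *: W e) *m E =
    map_mx (frame_der a) (map_mx (frame_der b) E)
    - map_mx (frame_der b) (map_mx (frame_der a) E)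
    + E *m \sum_e (frame_der a (E b e) - frame_der b (E a e)) *: w e.
  rewrite mulmx_suml.
  under eq_bigr => e _ do rewrite -scalemxAl WE scalerDr.
  rewrite big_split /=; congr (_ + _).
    apply/matrixP => i j; rewrite !mxE.
    rewrite (frame_der_commutator a b) summxE; apply: eq_bigr => e _.
    by rewrite !mxE.
  under eq_bigr => e _ do rewrite scalemxAr.
  rewrite -mulmx_sumr; congr (_ *m _).
  under [RHS]eq_bigr => e _ do rewrite -frame_bracketE scaler_suml.
  rewrite exchange_big /=; apply: eq_bigr => c _.
  rewrite /O scaler_sumr; apply: eq_bigr => e _.
  by rewrite scalerA.
have dO u v : map_mx (frame_der u) (O v) =
    \sum_e frame_der u (E v e) *: w e
    + \sum_k \sum_l (E u k * E v l) *: map_mx (d k) (w l).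
  rewrite [X in _ + X]exchange_big -big_split /= /O raddf_sum /=.
  apply: eq_bigr => e _; rewrite map_mx_derZ; congr (_ + _).
  rewrite map_mx_frame_der scaler_sumr; apply: eq_bigr => k _.
  by rewrite scalerA mulrC.
have OO u v : O u *m O v = \sum_k \sum_l (E u k * E v l) *: (w k *m w l).
  rewrite /O mulmx_suml; apply: eq_bigr => k _.
  rewrite mulmx_sumr; apply: eq_bigr => l _.
  by rewrite -scalemxAl -scalemxAr scalerA.
have RHSE : \sum_k \sum_l (E a k * E b l) *: frame_curvature d C0 w k l =
    \sum_k \sum_l (E a k * E b l) *: map_mx (d k) (w l)
    - \sum_k \sum_l (E b k * E a l) *: map_mx (d k) (w l)
    + O b *m O a - O a *m O b.
  rewrite !OO [X in _ - X + _ - _]exchange_big.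
  rewrite [X in _ - _ + X - _]exchange_big /=.
  rewrite -sumrB -big_split /= -sumrB; apply: eq_bigr => k _ /=.
  rewrite -sumrB -big_split /= -sumrB; apply: eq_bigr => l _ /=.
  rewrite frame_curvature0.
  by rewrite scalerBr scalerDr scalerBr [E b l * _]mulrC.
rewrite /frame_curvature 2!mulmxBl mulmxDl mulmxBl -/W CE !WWE !dWE RHSE.
rewrite !dO !mulmxDr !mulmxN.
under [X in _ - (_ + E *m X)]eq_bigr => e _ do rewrite scalerBl.
rewrite sumrB mulmxBr !mulmxA.
set x1 := map_mx _ (map_mx _ _); set x2 := map_mx _ (map_mx _ _).
move: (map_mx _ _ *m O b) (map_mx _ _ *m O a) (W b *m _) (W a *m _).
move=> y1 y2 y3 y4.
move: (E *m \sum_e _) (E *m \sum_e _) (E *m \sum_k _) (E *m \sum_k _).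
move: (E *m O b *m _) (E *m O a *m _) => z1 z2 z3 z4 z5 z6.
apply/matrixP => i j; rewrite !mxE.
by ring.
Qed.

(** Scalar curvature can be computed in any frame. *)
Lemma frame_scalarE gi w gi' : gi = E^T *m gi' *m E ->
  frame_scalar gi (frame_curvature d C0 w) =
  frame_scalar gi'
    (frame_curvature frame_der frame_bracket (frame_connection w)).
Proof.
move=> ->; set K := frame_curvature d C0 w.
have step b c : \sum_a
    frame_curvature frame_der frame_bracket (frame_connection w) a b c a =
    \sum_l \sum_j E b l * E c j * \sum_k K k l j k.
  under eq_bigr => a _.
    rewrite frame_curvatureE mxE.
    under eq_bigr => s _.
      rewrite mxE.
      under eq_bigr => j _.
        rewrite summxE.
        under eq_bigr => k _.
          rewrite summxE.
          under eq_bigr => l _ do rewrite mxE.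
          over.
        over.
      over.
    over.
  rewrite /= -/K.
  transitivity (\sum_a \sum_s \sum_j \sum_k \sum_l
      Ei s a * E a k * (E b l * E c j * K k l j s)).
    apply: eq_bigr => a _; apply: eq_bigr => s _.
    rewrite mulr_suml; apply: eq_bigr => j _.
    rewrite mulr_sumr mulr_suml; apply: eq_bigr => k _.
    rewrite mulr_sumr mulr_suml; apply: eq_bigr => l _.
    by ring.
  transitivity (\sum_s \sum_j \sum_k \sum_l
      (Ei *m E) s k * (E b l * E c j * K k l j s)).
    rewrite exchange_big /=; apply: eq_bigr => s _.
    rewrite exchange_big /=; apply: eq_bigr => j _.
    rewrite exchange_big /=; apply: eq_bigr => k _.
    rewrite exchange_big /=; apply: eq_bigr => l _.
    by rewrite [(Ei *m E) _ _]mxE mulr_suml.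
  rewrite EiE.
  transitivity (\sum_s \sum_j \sum_l E b l * E c j * K s l j s).
    apply: eq_bigr => s _; apply: eq_bigr => j _.
    rewrite (bigD1 s) //= [X in _ + X]big1 ?addr0; last first.
      move=> k /negPf ks; apply: big1 => l _.
      by rewrite [1%:M _ _]mxE eq_sym ks mul0r.
    by apply: eq_bigr => l _; rewrite [1%:M _ _]mxE eqxx mul1r.
  rewrite exchange_big [RHS]exchange_big /=; apply: eq_bigr => j _.
  rewrite exchange_big /=; apply: eq_bigr => l _.
  by rewrite mulr_sumr.
rewrite /frame_scalar.
under [RHS]eq_bigr => b _.
  under eq_bigr => c _.
    rewrite step mulr_sumr.
    under eq_bigr => l _ do rewrite mulr_sumr.
    over.
  rewrite exchange_big /=.
  under eq_bigr => l _ do rewrite exchange_big /=.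
  over.
rewrite /= [RHS]exchange_big /=; apply: eq_bigr => l _.
rewrite [RHS]exchange_big /=; apply: eq_bigr => j _.
move: (\sum_k K k l j k) => S.
rewrite mxE mulr_suml [RHS]exchange_big /=; apply: eq_bigr => c _.
rewrite mxE !mulr_suml; apply: eq_bigr => b _.
by rewrite mxE; ring.
Qed.

End Frames.

(** * The Levi-Civita connection and its curvature symmetries *)

Section Koszul.
Variables (B : comNzRingType) (n : nat) (d : 'I_n -> derivation B).
Variables (g gi : 'M[B]_n) (half : B).
Hypotheses (ggi : g *m gi = 1%:M) (gT : g^T = g) (half2 : half + half = 1).

(** The Christoffel symbols; half is the element 1/2 of the ring. *)
Definition koszul_connection i : 'M[B]_n := \matrix_(j, h)
  (half * \sum_m gi h m * (d i (g j m) + d j (g i m) - d m (g i j))).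

Lemma koszul_levi_civita : levi_civita d (fun _ _ => 0) g koszul_connection.
Proof.
have gS i j : g i j = g j i by rewrite -[in LHS]gT mxE.
have mulE k i j : (koszul_connection k *m g) i j =
    half * (d k (g i j) + d i (g k j) - d j (g k i)).
  transitivity (half * ((g *m gi) *m
      \col_m (d k (g i m) + d i (g k m) - d m (g k i))) j 0); last first.
    by rewrite ggi mul1mx mxE.
  rewrite -mulmxA [in RHS]mxE mxE mulr_sumr; apply: eq_bigr => h _.
  rewrite mxE (gS h j) [X in _ = half * (_ * X)]mxE -mulrA; congr (_ * _).
  by rewrite mulrC; congr (_ * _); apply: eq_bigr => m _; rewrite mxE.
split=> [k|a b].
  apply/matrixP => i j.
  have -> : g *m (koszul_connection k)^T = (koszul_connection k *m g)^T.
    by rewrite trmx_mul gT.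
  rewrite [RHS]mxE [X in _ = _ + X]mxE !mulE mxE (gS j i) (gS k j) (gS k i).
  by rewrite -[LHS]mul1r -half2; ring.
apply/rowP => h; rewrite !mxE -mulrBr -sumrB big1 ?mulr0 // => m _.
by rewrite (gS b a); ring.
Qed.

End Koszul.

Section LeviCivitaAlgebra.
Variables (B : comNzRingType) (n : nat) (d : 'I_n -> derivation B).
Hypothesis dC : forall i j x, d i (d j x) = d j (d i x).
Variables (g gi : 'M[B]_n) (Gam : 'I_n -> 'M[B]_n).
Hypotheses (ggi : g *m gi = 1%:M) (gT : g^T = g).
Hypothesis GamP : levi_civita d (fun _ _ => 0) g Gam.

Let Rm := frame_curvature d (fun _ _ => 0) Gam.

Lemma levi_civita_sym i j h : Gam i j h = Gam j i h.
Proof.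
have [_ /(_ i j)/rowP/(_ h)] := GamP.
by rewrite !mxE => /eqP; rewrite subr_eq0 => /eqP.
Qed.

Section Symmetries.
Hypothesis two_reg : forall x : B, x + x = 0 -> x = 0.

Let L k l j m := (Rm k l *m g) j m.

Lemma riemann_anti12 k l : Rm k l = - Rm l k.
Proof. by apply/matrixP => i j; rewrite /Rm !frame_curvature0 !mxE; ring. Qed.

(** Second derivatives of the metric commute. Expanding both orders by metric
compatibility, the terms mixing the two slots of g are symmetric, and what is
left is the curvature applied to g. *)
Lemma riemann_anti34 k l j m : L k l j m = - L k l m j.
Proof.
have [cg _] := GamP.
suff /matrixP/(_ j m) : Rm k l *m g + (Rm k l *m g)^T = 0.
  by rewrite [LHS]mxE [_^T _ _]mxE [RHS]mxE => /eqP; rewrite addr_eq0 => /eqP.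
have ddg a b : map_mx (d a) (map_mx (d b) g) =
    map_mx (d a) (Gam b) *m g + Gam b *m Gam a *m g + Gam b *m g *m (Gam a)^T
    + (map_mx (d a) (Gam b) *m g + Gam b *m Gam a *m g
       + Gam b *m g *m (Gam a)^T)^T.
  rewrite cg map_mxD !map_mx_derM !cg -map_trmx !linearD /= !trmx_mul !trmxK gT.
  rewrite mulmxDl !mulmxA -!addrA; do 3!congr (_ + _).
  by rewrite addrCA [RHS]addrC -addrA.
have : map_mx (d k) (map_mx (d l) g) = map_mx (d l) (map_mx (d k) g).
  by apply/matrixP => a b; rewrite !mxE dC.
rewrite !ddg /Rm frame_curvature0 => /eqP; rewrite -subr_eq0 => /eqP.
have tr a b : (Gam a *m g *m (Gam b)^T)^T = Gam b *m g *m (Gam a)^T.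
  by rewrite !trmx_mul trmxK gT mulmxA.
rewrite !linearD /= !tr => <-.
rewrite !(mulmxDl, mulNmx) !linearD /= !linearN /=.
by apply/matrixP => a b; rewrite !mxE; ring.
Qed.

(** The first Bianchi identity, from the symmetry of the Christoffel symbols. *)
Lemma riemann_bianchi k l j s : Rm k l j s + Rm l j k s + Rm j k l s = 0.
Proof.
rewrite /Rm !frame_curvature0 !mxE.
have D a b c s' : d a (Gam b c s') = d a (Gam c b s').
  by rewrite levi_civita_sym.
have E a b c : \sum_m Gam a c m * Gam b m s = \sum_m Gam c a m * Gam b m s.
  by apply: eq_bigr => m _; rewrite levi_civita_sym.
rewrite (D k j l) (D l k j) (D j l k).
by rewrite (E l k j) (E k l j) (E l j k); ring.
Qed.

(** Four Bianchi identities, one for each choice of the fixed last index, add up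
with suitable signs to twice the claim: every other component occurs twice and
cancels by antisymmetry. *)
Lemma riemann_pair k l j m : L k l j m = L j m k l.
Proof.
have a12 a b c e : L a b c e = - L b a c e.
  by rewrite /L riemann_anti12 mulNmx mxE.
have a34 := riemann_anti34.
have bianchi a b c e : L a b c e + L b c a e + L c a b e = 0.
  rewrite /L !mxE -!big_split big1 //= => s _.
  by rewrite -!mulrDl riemann_bianchi mul0r.
apply/eqP; rewrite -subr_eq0; apply/eqP; apply: two_reg.
transitivity ((L k l j m + L l j k m + L j k l m)
  + (L l k m j + L k m l j + L m l k j)
  - (L j m k l + L m k j l + L k j m l)
  - (L m j l k + L j l m k + L l m j k)); last by rewrite !bianchi !subr0 addr0.
rewrite (a12 l k m j) (a34 k l m j) (a12 m l k j) (a34 l m k j).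
rewrite (a12 m j l k) (a34 j m l k) (a12 k j m l) (a34 j k m l).
rewrite (a12 m k j l) (a34 k m j l) (a12 j l m k) (a34 l j m k).
by ring.
Qed.

End Symmetries.

(** * Conformal change of the metric *)

Section Conformal.
Variables (half f fi : B).
Hypotheses (half2 : half + half = 1) (ffi : f * fi = 1).

(** The tensor A/(2f), that is, the difference between the Levi-Civita
connections of f g and g; fi stands for 1/f. *)
Definition conformal_shift k : 'M[B]_n := \matrix_(i, h)
  (half * fi * (d k f * (i == h)%:R + d i f * (k == h)%:R
                - (\sum_m gi h m * d m f) * g k i)).
Let S := conformal_shift.

Lemma conformal_shift_sym k i h : S k i h = S i k h.
Proof. by rewrite !mxE -{1}gT mxE; ring. Qed.

(** With its last index lowered by f g, the shift is free of 1/f, and its part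
symmetric in i and j is d_k f g_ij / 2, as metric compatibility requires. *)
Lemma conformal_shift_mul k i j : (S k *m (f *: g)) i j =
  half * (d k f * g i j + d i f * g k j - d j f * g k i).
Proof.
have sum_row a : \sum_h (a == h)%:R * g h j = g a j.
  by under eq_bigr => h _ do rewrite eq_sym; exact: sum_delta.
have sum_grad : \sum_h (\sum_m gi h m * d m f) * g h j = d j f.
  have -> : \sum_h (\sum_m gi h m * d m f) * g h j =
      ((g *m gi) *m \col_m d m f) j 0.
    rewrite -mulmxA [RHS]mxE; apply: eq_bigr => h _.
    rewrite mulrC -{1}gT mxE [in RHS]mxE; congr (_ * _).
    by apply: eq_bigr => m _; rewrite mxE.
  by rewrite ggi mul1mx mxE.
rewrite mxE -[in RHS]sum_row -[in RHS](sum_row k) -[in RHS]sum_grad.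
rewrite [_ * \sum_h _ in RHS]mulr_sumr [d i f * _]mulr_sumr mulr_suml.
rewrite -big_split -sumrB mulr_sumr; apply: eq_bigr => h _ /=.
rewrite !mxE; set G := \sum_m _; transitivity (f * fi * half *
  ((d k f * (i == h)%:R + d i f * (k == h)%:R - G * g k i) * g h j)).
  by ring.
by rewrite ffi; ring.
Qed.

Lemma conformal_levi_civita :
  levi_civita d (fun _ _ => 0) (f *: g) (fun k => Gam k + S k).
Proof.
have [cg tg] := GamP; split=> [k|a b]; last first.
  apply/rowP => h; have := conformal_shift_sym a b h; move: (S) => T symT.
  by rewrite !mxE levi_civita_sym symT subrr.
rewrite map_mx_derZ cg; apply/matrixP => i j.
rewrite [(_ + _)^T]linearD [in RHS]mulmxDl mulmxDr.
have -> : f *: g *m (S k)^T = (S k *m (f *: g))^T.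
  by rewrite trmx_mul linearZ /= gT.
rewrite addrACA -scalemxAr -scalemxAl.
have mxEs : forall X1 X2 X3 X4 : 'M[B]_n,
  (f *: X1 + f *: X2 + (X3 + X4^T)) i j =
  (f *: (X1 + X2)) i j + (X3 i j + X4 j i).
  by move=> *; rewrite !mxE; ring.
rewrite mxEs !conformal_shift_mul [LHS]mxE addrC; congr (_ + _).
have -> : g j i = g i j by rewrite -[in LHS]gT mxE.
rewrite mxE.
transitivity ((half + half) * (d k f * g i j)); last by ring.
by rewrite half2 mul1r.
Qed.

Definition cov_shift r l j h : B :=
  d r (S l j h) + \sum_s (Gam r s h * S l j s - Gam r l s * S s j h
                          - Gam r j s * S l s h).

(** The curvature of Gam + S is that of Gam, plus the antisymmetrized covariant
derivative of S, plus the commutators of S. The Christoffel term for the index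
of differentiation is symmetric and disappears. *)
Lemma conformal_scalar :
  frame_scalar (fi *: gi)
    (frame_curvature d (fun _ _ => 0) (fun k => Gam k + S k)) =
  fi * frame_scalar gi Rm + fi * \sum_l \sum_j gi l j *
    (\sum_r cov_shift r l j r - \sum_r cov_shift l r j r
     + \sum_r \sum_s S r s r * S l j s - \sum_r \sum_s S l s r * S r j s).
Proof.
rewrite -mulrDr /frame_scalar -big_split mulr_sumr; apply: eq_bigr => l _ /=.
rewrite -big_split mulr_sumr; apply: eq_bigr => j _ /=.
rewrite mxE -mulrA -mulrDr; congr (_ * (_ * _)).
rewrite -sumrB -big_split -sumrB -big_split /=; apply: eq_bigr => r _.
rewrite frame_curvature0 /Rm frame_curvature0.
have covE k l' h : cov_shift k l' j h = (map_mx (d k) (S l') +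
    S l' *m Gam k - Gam k *m S l') j h - \sum_s Gam k l' s * S s j h.
  rewrite /cov_shift !sumrB; move: (S) => T; rewrite !mxE -!addrA.
  congr (_ + _).
  rewrite [- \sum_i _ - _]addrC addrA addrA; congr (_ - _ - _).
  by apply: eq_bigr => s _; rewrite mulrC.
rewrite !covE.
have -> : \sum_s Gam r l s * S s j r = \sum_s Gam l r s * S s j r.
  by apply: eq_bigr => s _; rewrite levi_civita_sym.
have -> : \sum_s S r s r * S l j s = (S l *m S r) j r.
  by rewrite [RHS]mxE; apply: eq_bigr => s _; rewrite mulrC.
have -> : \sum_s S l s r * S r j s = (S r *m S l) j r.
  by rewrite [RHS]mxE; apply: eq_bigr => s _; rewrite mulrC.
rewrite !map_mxD !mulmxDl !mulmxDr; move: (S) (\sum_s _) => T x.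
move: (map_mx _ _) (map_mx _ _) (map_mx _ _) (map_mx _ _).
move: (_ *m _) (_ *m _) (_ *m _) (_ *m _) (_ *m _) (_ *m _) (_ *m _) (_ *m _).
by move=> *; rewrite !mxE; ring.
Qed.

End Conformal.

End LeviCivitaAlgebra.

(** * Riemannian submersions with flat parallel fibres *)

Section Submersion.
Variables (B : comNzRingType) (n m : nat) (d : 'I_(n + m) -> derivation B).
Hypothesis dC : forall i j x, d i (d j x) = d j (d i x).
Variable half : B.
Hypothesis half2 : half + half = 1.

Let dh i := d (lshift m i).
Let dv a := d (rshift n a).

Variables (gb gbi : 'M[B]_n) (h hi : 'M[B]_m) (H : 'M[B]_(n, m)).
Variable wb : 'I_n -> 'M[B]_n.

(** The first n coordinates are those of the base and the last m those of the
fibres. The horizontal lift of the i-th base field is dh i + sum_a H i a dv a;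
its bracket with dv a is vertical, with components row a of this matrix. *)
Definition fibre_connection i : 'M[B]_m := \matrix_(a, b) - dv a (H i b).
Let K := fibre_connection.

(** The vertical components of the bracket of the i-th and j-th horizontal
lifts. *)
Definition hor_curvature i : 'M[B]_(n, m) := \matrix_(j, a)
  (dh i (H j a) + \sum_b H i b * dv b (H j a)
   - (dh j (H i a) + \sum_b H j b * dv b (H i a))).
Let Om := hor_curvature.

Definition hor_frame : 'M[B]_(n + m) := block_mx 1%:M H 0 1%:M.
Definition hor_coframe : 'M[B]_(n + m) := block_mx 1%:M (- H) 0 1%:M.
Let E := hor_frame.
Let Ei := hor_coframe.

Lemma hor_frameK : E *m Ei = 1%:M.
Proof.
rewrite mulmx_block !mulmx1 !mul1mx !mulmx0 !mul0mx addr0 addr0 add0r.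
by rewrite addNr -scalar_mx_block.
Qed.

Lemma hor_coframeK : Ei *m E = 1%:M.
Proof.
rewrite mulmx_block !mulmx1 !mul1mx !mulmx0 !mul0mx addr0 addr0 add0r.
by rewrite subrr -scalar_mx_block.
Qed.

Let D := frame_der d E.
Let C := frame_bracket d E Ei.

Lemma hor_frame_derl i x :
  D (lshift m i) x = dh i x + \sum_b H i b * dv b x.
Proof.
rewrite /D frame_derE big_split_ord /=; congr (_ + _).
  rewrite (bigD1 i) //= big1 ?addr0.
    by rewrite block_mxEul mxE eqxx mul1r.
  by move=> p /negPf pi; rewrite block_mxEul mxE eq_sym pi mul0r.
by apply: eq_bigr => b _; rewrite block_mxEur.
Qed.

Lemma hor_frame_derr a x : D (rshift n a) x = dv a x.
Proof.
rewrite /D frame_derE big_split_ord /= big1 ?add0r; last first.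
  by move=> p _; rewrite block_mxEdl mxE mul0r.
rewrite (bigD1 a) //= big1 ?addr0.
  by rewrite block_mxEdr mxE eqxx mul1r.
by move=> p /negPf pi; rewrite block_mxEdr mxE eq_sym pi mul0r.
Qed.

Lemma vertical_coframe (v : 'rV[B]_m) : row_mx 0 v *m Ei = row_mx 0 v.
Proof. by rewrite mul_row_block !mul0mx mulmx0 mulmx1 !add0r. Qed.

Lemma row_hor_framel i : row (lshift m i) E = row_mx (row i 1%:M) (row i H).
Proof. by rewrite -row_usubmx /E /hor_frame block_mxEv col_mxKu row_row_mx. Qed.

Lemma row_hor_framer a : row (rshift n a) E = row_mx 0 (row a 1%:M).
Proof.
by rewrite -row_dsubmx /E /hor_frame block_mxEv col_mxKd row_row_mx row0.
Qed.

Lemma hor_bracketll i j :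
  C (lshift m i) (lshift m j) = row_mx 0 (row j (Om i)).
Proof.
rewrite -vertical_coframe /C /frame_bracket !row_hor_framel; congr (_ *m _).
rewrite !map_row_mx !map_row !map_mx_der1 !row0 opp_row_mx add_row_mx subr0.
congr row_mx; apply/rowP => a; rewrite !mxE.
by rewrite -/D !hor_frame_derl.
Qed.

Lemma hor_bracketlr i a :
  C (lshift m i) (rshift n a) = row_mx 0 (row a (K i)).
Proof.
rewrite -vertical_coframe /C /frame_bracket row_hor_framel row_hor_framer.
congr (_ *m _).
rewrite !map_row_mx !map_row !map_mx_der1 !row0 map_mx0 opp_row_mx add_row_mx.
rewrite subr0 sub0r; congr row_mx; apply/rowP => b; rewrite !mxE.
by rewrite -/D hor_frame_derr.
Qed.

Lemma hor_bracketrl a i :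
  C (rshift n a) (lshift m i) = row_mx 0 (- row a (K i)).
Proof.
rewrite -vertical_coframe /C /frame_bracket row_hor_framel row_hor_framer.
congr (_ *m _).
rewrite !map_row_mx !map_row !map_mx_der1 !row0 map_mx0 opp_row_mx add_row_mx.
rewrite subr0 subr0; congr row_mx; apply/rowP => b; rewrite !mxE.
by rewrite -/D hor_frame_derr opprK.
Qed.

Lemma hor_bracketrr a b : C (rshift n a) (rshift n b) = 0.
Proof.
rewrite /C /frame_bracket !row_hor_framer.
by rewrite !map_row_mx !map_row !map_mx_der1 !map_mx0 !row0 subrr mul0mx.
Qed.

Lemma hor_curvature_anti i j a : Om i j a = - Om j i a.
Proof. by rewrite !mxE opprB. Qed.

(** Twice O'Neill's tensor: half of oneill i gives the horizontal part of
nabla_(E_i) V for vertical V. It is minus the adjoint of hor_curvature i. *)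
Definition oneill i : 'M[B]_(m, n) := - (h *m (Om i)^T *m gbi).
Let F := oneill.

(** The same components sorted by the vertical field: half of them give
nabla_V E_i, which is horizontal and differs from nabla_(E_i) V by the vertical
bracket. *)
Definition oneill_vert a : 'M[B]_n := \matrix_(i, k) F i a k.
Let Phi := oneill_vert.

(** The Levi-Civita connection in the frame of horizontal lifts and vertical
coordinate fields, for fibres that are flat and totally geodesic: vertical
fields have no covariant derivative along each other. *)
Definition submersion_connection (c : 'I_(n + m)) : 'M[B]_(n + m) :=
  match fintype.split c with
  | inl i => block_mx (wb i) (half *: Om i) (half *: F i) (K i)
  | inr a => block_mx (half *: Phi a) 0 0 0
  end.
Let w := submersion_connection.

Lemma submersion_connectionl i : w (lshift m i) =
  block_mx (wb i) (half *: Om i) (half *: F i) (K i).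
Proof. by rewrite /w /submersion_connection (unsplitK (inl i)). Qed.

Lemma submersion_connectionr a :
  w (rshift n a) = block_mx (half *: Phi a) 0 0 0.
Proof. by rewrite /w /submersion_connection (unsplitK (inr a)). Qed.

Hypotheses (gbgbi : gb *m gbi = 1%:M) (gbT : gb^T = gb).
Hypotheses (hhi : h *m hi = 1%:M) (hT : h^T = h).
Hypothesis dv_gb : forall a, map_mx (dv a) gb = 0.
Hypothesis dv_h : forall a, map_mx (dv a) h = 0.
Hypothesis dh_h : forall i, map_mx (dh i) h = K i *m h + h *m (K i)^T.
Hypothesis wbP : levi_civita dh (fun _ _ => 0) gb wb.
Hypothesis dv_wb : forall a i, map_mx (dv a) (wb i) = 0.

Let gbigb : gbi *m gb = 1%:M.
Proof. exact: mulmx1C. Qed.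

Let gbiT : gbi^T = gbi.
Proof. exact: sym_inverse gbgbi gbT. Qed.

Let G' := block_mx gb 0 0 h.

Let map_dh p q (P : 'M[B]_(p, q)) i : (forall a, map_mx (dv a) P = 0) ->
  map_mx (D (lshift m i)) P = map_mx (dh i) P.
Proof.
move=> dvP; apply/matrixP => k l; rewrite !mxE hor_frame_derl big1 ?addr0 //.
move=> b _; have /matrixP/(_ k l) := dvP b.
by rewrite !mxE => ->; rewrite mulr0.
Qed.

Let map_dv p q (P : 'M[B]_(p, q)) a :
  map_mx (D (rshift n a)) P = map_mx (dv a) P.
Proof. by apply/matrixP => k l; rewrite !mxE hor_frame_derr. Qed.

Lemma oneill_vert_mul a : Phi a *m gb = \matrix_(i, j) - (Om i *m h) j a.
Proof.
apply/matrixP => i j; rewrite mxE.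
transitivity ((F i *m gb) a j).
  by rewrite mxE; apply: eq_bigr => k _; rewrite mxE.
rewrite /F /oneill mulNmx -(mulmxA _ gbi) gbigb mulmx1 !mxE; congr (- _).
apply: eq_bigr => b _; rewrite [_^T _ _]mxE mulrC; congr (_ * _).
by rewrite -[in LHS]hT mxE.
Qed.

(** The off-diagonal blocks of metric compatibility say that oneill i is minus
the adjoint of hor_curvature i. Along a vertical field, compatibility is the
antisymmetry of hor_curvature in its two horizontal arguments, and in the lower
right block it is the parallelism of the fibre metric. *)
Lemma submersion_levi_civita : levi_civita D C G' w.
Proof.
have [cb tb] := wbP.
split=> [c|c c'].
  case: (split_ordP c) => [i|a] ->.
    rewrite submersion_connectionl tr_block_mx !mulmx_block !map_block_mx.
    rewrite !mulmx0 !mul0mx !addr0 !add0r add_block_mx !map_mx0.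
    rewrite !map_dh // cb dh_h; congr block_mx.
      rewrite linearZ /= -scalemxAl -scalemxAr -scalerDr.
      rewrite /F /oneill linearN /= !trmx_mul trmxK gbiT hT mulmxN !mulmxA.
      by rewrite gbgbi mul1mx subrr scaler0.
    rewrite linearZ /= -scalemxAl -scalemxAr -scalerDr.
    rewrite /F /oneill mulNmx -!mulmxA gbigb mulmx1 addNr.
    by rewrite scaler0.
  rewrite submersion_connectionr tr_block_mx !mulmx_block !map_block_mx.
  rewrite !trmx0 !mulmx0 !mul0mx !addr0 add_block_mx !map_mx0 !map_dv.
  rewrite dv_gb dv_h !addr0; congr block_mx.
  rewrite linearZ /= -scalemxAl -scalemxAr -scalerDr.
  have -> : gb *m (Phi a)^T = (Phi a *m gb)^T by rewrite trmx_mul gbT.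
  rewrite oneill_vert_mul; apply/matrixP => i j; rewrite ![in RHS]mxE.
  rewrite -opprD -big_split big1 ?oppr0 ?mulr0 ?mxE //= => b _.
  by rewrite -mulrDl hor_curvature_anti addNr mul0r.
have rowPhi a i : row i (Phi a) = row a (F i).
  by apply/rowP => k; rewrite mxE [in RHS]mxE mxE.
case: (split_ordP c) => [i|a] ->; case: (split_ordP c') => [j|b] ->.
- rewrite hor_bracketll !submersion_connectionl !block_mxEv.
  rewrite -!row_usubmx !col_mxKu !row_row_mx opp_row_mx add_row_mx.
  have rowOm : row i (Om j) = - row j (Om i).
    by apply/rowP => a; rewrite mxE hor_curvature_anti !mxE.
  by rewrite tb !linearZ /= rowOm opprK -scalerDl half2 scale1r.
- rewrite hor_bracketlr submersion_connectionl submersion_connectionr.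
  rewrite !block_mxEv -row_usubmx -row_dsubmx col_mxKu col_mxKd !row_row_mx.
  rewrite opp_row_mx add_row_mx row0 subr0; congr row_mx.
  by rewrite !linearZ /= rowPhi scalerN subrr.
- rewrite hor_bracketrl submersion_connectionl submersion_connectionr.
  rewrite !block_mxEv -row_usubmx -row_dsubmx col_mxKu col_mxKd !row_row_mx.
  rewrite opp_row_mx add_row_mx row0 sub0r; congr row_mx.
  by rewrite !linearZ /= rowPhi scalerN subrr.
- rewrite hor_bracketrr !submersion_connectionr !block_mxEv -!row_dsubmx.
  by rewrite !col_mxKd row_mx0 !row0 subrr.
Qed.

Let R := frame_curvature D C w.
Let Rb := frame_curvature dh (fun _ _ => 0) wb.
Let P i j k l := (Om i *m h *m (Om k)^T) j l.

Let vertical_sum (v : 'rV[B]_m) : \sum_e row_mx 0 v 0 e *: w e =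
  block_mx (half *: \sum_a v 0 a *: Phi a) 0 0 0.
Proof.
rewrite big_split_ord /= big1 ?add0r; last first.
  by move=> i _; rewrite row_mxEl mxE scale0r.
under eq_bigr => a _ do rewrite row_mxEr submersion_connectionr scale_block_mx
  !scaler0 scalerA mulrC -scalerA.
apply: (big_ind2 (fun x y => x = block_mx (half *: y) 0 0 0)).
- by rewrite scaler0 -block_mx0.
- by move=> _ x _ y -> ->; rewrite add_block_mx !addr0 -scalerDr.
- by [].
Qed.

Let sum_oneill_vert (v : 'rV[B]_m) k l :
  (\sum_a v 0 a *: Phi a) k l = (v *m F k) 0 l.
Proof.
by rewrite summxE mxE; apply: eq_bigr => a _; rewrite mxE [Phi a _ _]mxE.
Qed.

Let OmF i j k l : (Om i *m F k) j l = - \sum_p P i j k p * gbi p l.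
Proof.
rewrite /F /oneill mulmxN mulmxA mulmxA mxE; congr (- _).
by rewrite mxE.
Qed.

(** Of each curvature matrix, only the block that meets the trace in the scalar
curvature is computed. *)
Lemma submersion_curvature_hh i j k l :
  R (lshift m i) (lshift m j) (lshift m k) (lshift m l) =
  Rb i j k l - half * half * (\sum_p P j k i p * gbi p l)
  + half * half * (\sum_p P i k j p * gbi p l)
  + half * (\sum_p P i j k p * gbi p l).
Proof.
rewrite /R /frame_curvature hor_bracketll vertical_sum !submersion_connectionl.
rewrite !map_block_mx !mulmx_block !opp_block_mx !add_block_mx block_mxEul.
rewrite !map_dh // -!scalemxAl -!scalemxAr !scalerA.
rewrite /Rb frame_curvature0.
have -> : half *: (\sum_a row j (Om i) 0 a *: Phi a) =
    \matrix_(k, l) (half * (Om i *m F k) j l).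
  apply/matrixP => k' l'; rewrite [LHS]mxE sum_oneill_vert -row_mul.
  by rewrite [RHS]mxE [row _ _ _ _]mxE.
have mxEs c (X1 X2 X3 X4 X5 X6 X7 : 'M[B]_n) :
  (X1 - X2 + (X3 + c *: X5) - (X4 + c *: X6) - X7) k l =
  (X1 - X2 + X3 - X4) k l + c * X5 k l - c * X6 k l - X7 k l.
  by rewrite !mxE; ring.
rewrite mxEs [(\matrix_(_, _) _) k l]mxE !OmF.
by rewrite !mulrN !opprK.
Qed.

Lemma submersion_curvature_vh a j k b :
  R (rshift n a) (lshift m j) (lshift m k) (rshift n b) =
  half * dv a (Om j k b) - half * half * \sum_l F k a l * Om j l b.
Proof.
rewrite /R /frame_curvature hor_bracketrl vertical_sum submersion_connectionl.
rewrite submersion_connectionr !map_block_mx !mulmx_block !opp_block_mx.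
rewrite !add_block_mx block_mxEur !map_mx0 !mulmx0 !mul0mx !addr0 !subr0.
rewrite map_dv map_mx_derZ -!scalemxAl -!scalemxAr scalerA.
rewrite (der_half _ half2) scale0r !add0r.
have mxEs c c' (X1 X2 : 'M[B]_(n, m)) :
  (c *: X1 - c' *: X2) k b = c * X1 k b - c' * X2 k b by rewrite !mxE.
rewrite mxEs [map_mx _ _ _ _]mxE [(Phi a *m _) _ _]mxE.
by under eq_bigr => l _ do rewrite [Phi a _ _]mxE.
Qed.

Lemma submersion_curvature_hv i b c k :
  R (lshift m i) (rshift n b) (rshift n c) (lshift m k) =
  - (half * dv b (F i c k)) - half * half * \sum_p F i c p * F p b k.
Proof.
rewrite /R /frame_curvature hor_bracketlr vertical_sum submersion_connectionl.
rewrite submersion_connectionr !map_block_mx !mulmx_block !opp_block_mx.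
rewrite !add_block_mx block_mxEdl !map_mx0 !mulmx0 !mul0mx !addr0 !subr0.
rewrite map_dv map_mx_derZ -!scalemxAl -!scalemxAr scalerA.
rewrite (der_half _ half2) scale0r !add0r.
have mxEs r r' (X1 X2 : 'M[B]_(m, n)) :
  (- (r *: X1) - r' *: X2) c k = - (r * X1 c k) - r' * X2 c k by rewrite !mxE.
rewrite mxEs [map_mx _ _ _ _]mxE [(_ *m Phi b) _ _]mxE.
by under eq_bigr => l _ do rewrite [Phi b _ _]mxE.
Qed.

Lemma submersion_curvature_vv a b c e :
  R (rshift n a) (rshift n b) (rshift n c) (rshift n e) = 0.
Proof.
rewrite /R /frame_curvature hor_bracketrr !submersion_connectionr.
rewrite big1 ?subr0; last by move=> x _; rewrite mxE scale0r.
rewrite !map_block_mx !mulmx_block !opp_block_mx !add_block_mx block_mxEdr.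
by rewrite !(map_mx0, mulmx0, mul0mx, addr0, oppr0) mxE.
Qed.

Let two_reg (x : B) : x + x = 0 -> x = 0.
Proof. exact: half_reg half2. Qed.

Let gbiS i j : gbi i j = gbi j i.
Proof. by rewrite -[in LHS]gbiT mxE. Qed.

Let sum_anti (f : 'I_n -> 'I_n -> B) : (forall j k, f j k = - f k j) ->
  \sum_j \sum_k gbi j k * f j k = 0.
Proof.
move=> fA; apply: two_reg; rewrite {1}exchange_big -big_split big1 //= => j _.
by rewrite -big_split big1 //= => k _; rewrite fA gbiS mulrN addNr.
Qed.

Let P12 i j k l : P i j k l = - P j i k l.
Proof.
rewrite /P -!mulmxA [LHS]mxE [X in - X]mxE -sumrN; apply: eq_bigr => a _.
by rewrite hor_curvature_anti mulNr.
Qed.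

Let Psym i j k l : P i j k l = P k l i j.
Proof.
by rewrite /P -[in LHS](trmxK (Om i)) -[in LHS]hT -!trmx_mul mxE mulmxA.
Qed.

Let P34 i j k l : P i j k l = - P i j l k.
Proof. by rewrite Psym P12 Psym. Qed.

(** The square norm of the horizontal curvature, for the metrics gb and h. *)
Definition curvature_square : B := \sum_i \sum_k \sum_j \sum_l
  gbi i k * gbi j l * (Om i *m h *m (Om k)^T) j l.
Let Q := curvature_square.

(** The quadratic terms of the four kinds of curvature components all contract to
the square norm, up to a sign. *)
Let sumB : \sum_j \sum_k gbi j k * (\sum_i \sum_p P i k j p * gbi p i) = - Q.
Proof.
rewrite /Q /curvature_square -sumrN.
under eq_bigr => j _.
  under eq_bigr => k _ do rewrite mulr_sumr.
  rewrite exchange_big /=.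
  over.
rewrite exchange_big /=; apply: eq_bigr => i _.
under eq_bigr => j _.
  under eq_bigr => k _ do rewrite mulr_sumr.
  rewrite exchange_big /=.
  over.
rewrite exchange_big /= -sumrN; apply: eq_bigr => p _.
rewrite exchange_big /= -sumrN; apply: eq_bigr => k _.
rewrite -sumrN; apply: eq_bigr => j _.
by rewrite -/(P i k p j) P34 (gbiS p i) (gbiS j k); ring.
Qed.

Let sumC : \sum_j \sum_k gbi j k * (\sum_i \sum_p P i j k p * gbi p i) = - Q.
Proof.
rewrite -sumB exchange_big; apply: eq_bigr => k _; apply: eq_bigr => j _ /=.
by rewrite gbiS.
Qed.

Let sumD : \sum_j \sum_k gbi j k * (\sum_a \sum_l F k a l * Om j l a) = - Q.
Proof.
rewrite /Q /curvature_square -sumrN; apply: eq_bigr => j _.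
rewrite -sumrN; apply: eq_bigr => k _.
rewrite exchange_big /= mulr_sumr -sumrN; apply: eq_bigr => l _.
have -> : \sum_a F k a l * Om j l a = (Om j *m F k) l l.
  by rewrite [RHS]mxE; apply: eq_bigr => a _; rewrite mulrC.
rewrite OmF mulrN mulr_sumr; congr (- _); apply: eq_bigr => p _.
by rewrite -/(P j l k p) (gbiS p l); ring.
Qed.

(** This trace pairs the symmetric gbi with the antisymmetric hor_curvature; so
the derivatives of O'Neill's tensor do not contribute. *)
Let oneill_trace c : \sum_i F i c i = 0.
Proof.
transitivity (- \sum_i \sum_q gbi i q * (h *m (Om i)^T) c q).
  rewrite -sumrN; apply: eq_bigr => i _; rewrite [LHS]mxE [X in - X]mxE.
  by congr (- _); apply: eq_bigr => q _; rewrite mulrC gbiS.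
rewrite sum_anti ?oppr0 // => j k; rewrite [LHS]mxE [X in - X]mxE -sumrN.
apply: eq_bigr => a _; rewrite [_^T _ _]mxE [(Om k)^T _ _]mxE.
by rewrite hor_curvature_anti mulrN opprK.
Qed.

Let sumF :
  \sum_b \sum_c hi b c * (\sum_i \sum_p F i c p * F p b i) = - Q.
Proof.
transitivity (\sum_i \sum_p ((F p)^T *m hi *m F i) i p).
  under eq_bigr => b _.
    under eq_bigr => c _ do rewrite mulr_sumr.
    rewrite exchange_big /=.
    over.
  rewrite exchange_big /=; apply: eq_bigr => i _.
  under eq_bigr => b _.
    under eq_bigr => c _ do rewrite mulr_sumr.
    rewrite exchange_big /=.
    over.
  rewrite exchange_big /=; apply: eq_bigr => p _.
  rewrite exchange_big [RHS]mxE /=; apply: eq_bigr => c _.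
  rewrite [(_ *m hi) _ _]mxE mulr_suml; apply: eq_bigr => b _.
  by rewrite [_^T _ _]mxE; ring.
have FhF i p : (F p)^T *m hi *m F i = gbi *m (Om p *m h *m (Om i)^T) *m gbi.
  rewrite /F /oneill [(- _)^T]linearN /= !trmx_mul trmxK hT gbiT.
  by rewrite mulNmx mulNmx mulmxN opprK !mulmxA -(mulmxA _ h hi) hhi mulmx1.
rewrite exchange_big /= /Q /curvature_square -sumrN; apply: eq_bigr => p _.
rewrite -sumrN.
transitivity (\sum_i \sum_k gbi k p * (gbi *m (Om p *m h *m (Om i)^T)) i k).
  apply: eq_bigr => i _; rewrite FhF [LHS]mxE; apply: eq_bigr => k _.
  by rewrite mulrC.
rewrite exchange_big /=; apply: eq_bigr => k _.
rewrite -sumrN.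
transitivity (\sum_i \sum_j gbi k p * (gbi i j * P p j i k)).
  by apply: eq_bigr => i _; rewrite [X in _ * X]mxE mulr_sumr.
rewrite exchange_big /=; apply: eq_bigr => j _.
rewrite -sumrN; apply: eq_bigr => l _.
by rewrite -/(P p j k l) P34 (gbiS k p) (gbiS l j); ring.
Qed.

Let Gi' := block_mx gbi 0 0 hi.

(** The purely horizontal components contribute -3/4 of the square norm, and the
mixed components 1/4 for each of the two places of the vertical argument. *)
Lemma submersion_scalar : frame_scalar Gi' R =
  frame_scalar gbi Rb - half * half * Q.
Proof.
have scalar_split : frame_scalar Gi' R =
    \sum_j \sum_k gbi j k *
      (\sum_i R (lshift m i) (lshift m j) (lshift m k) (lshift m i)
       + \sum_a R (rshift n a) (lshift m j) (lshift m k) (rshift n a))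
    + \sum_b \sum_c hi b c *
      (\sum_i R (lshift m i) (rshift n b) (rshift n c) (lshift m i)
       + \sum_a R (rshift n a) (rshift n b) (rshift n c) (rshift n a)).
  rewrite /frame_scalar big_split_ord /=; congr (_ + _).
    apply: eq_bigr => j _; rewrite big_split_ord /= [X in _ + X]big1 ?addr0.
      by apply: eq_bigr => k _; rewrite block_mxEul big_split_ord.
    by move=> b _; rewrite block_mxEur mxE mul0r.
  apply: eq_bigr => j _; rewrite big_split_ord /= [X in X + _]big1 ?add0r.
    by apply: eq_bigr => k _; rewrite block_mxEdr big_split_ord.
  by move=> b _; rewrite block_mxEdl mxE mul0r.
rewrite scalar_split.
have -> : \sum_b \sum_c hi b c *
      (\sum_i R (lshift m i) (rshift n b) (rshift n c) (lshift m i)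
       + \sum_a R (rshift n a) (rshift n b) (rshift n c) (rshift n a)) =
    half * half * Q.
  transitivity (- (half * half *
      \sum_b \sum_c hi b c * (\sum_i \sum_p F i c p * F p b i))).
    rewrite mulr_sumr -sumrN; apply: eq_bigr => b _.
    rewrite mulr_sumr -sumrN; apply: eq_bigr => c _.
    rewrite [X in _ * (_ + X)]big1 ?addr0; last first.
      by move=> a _; rewrite submersion_curvature_vv.
    under eq_bigr => i _ do rewrite submersion_curvature_hv.
    rewrite sumrB sumrN -!mulr_sumr.
    have -> : \sum_i dv b (F i c i) = 0.
      by rewrite -raddf_sum oneill_trace raddf0.
    by ring.
  by rewrite sumF mulrN opprK.
pose S1 j k := \sum_i \sum_p P j k i p * gbi p i.
pose S2 j k := \sum_a dv a (Om j k a).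
have step j k : \sum_i R (lshift m i) (lshift m j) (lshift m k) (lshift m i)
       + \sum_a R (rshift n a) (lshift m j) (lshift m k) (rshift n a) =
    \sum_i Rb i j k i - half * half * S1 j k
    + half * half * (\sum_i \sum_p P i k j p * gbi p i)
    + half * (\sum_i \sum_p P i j k p * gbi p i)
    + (half * S2 j k - half * half * \sum_a \sum_l F k a l * Om j l a).
  under eq_bigr => i _ do rewrite submersion_curvature_hh.
  rewrite !big_split /= sumrN -!mulr_sumr; congr (_ + _).
  under eq_bigr => a _ do rewrite submersion_curvature_vh.
  by rewrite sumrB -!mulr_sumr.
transitivity (frame_scalar gbi Rb
  - half * half * (\sum_j \sum_k gbi j k * S1 j k)
  + half * half *
      (\sum_j \sum_k gbi j k * (\sum_i \sum_p P i k j p * gbi p i))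
  + half * (\sum_j \sum_k gbi j k * (\sum_i \sum_p P i j k p * gbi p i))
  + half * (\sum_j \sum_k gbi j k * S2 j k)
  - half * half *
      (\sum_j \sum_k gbi j k * (\sum_a \sum_l F k a l * Om j l a))
  + half * half * Q).
  congr (_ + _); rewrite /frame_scalar !mulr_sumr -!sumrN -!big_split /=.
  apply: eq_bigr => j _.
  rewrite !mulr_sumr -!sumrN -!big_split /=.
  by apply: eq_bigr => k _; rewrite step; ring.
rewrite sumB sumC sumD !sum_anti; last 2 first.
- move=> j k; rewrite /S2 -sumrN; apply: eq_bigr => a _.
  by rewrite hor_curvature_anti raddfN.
- move=> j k; rewrite /S1 -sumrN; apply: eq_bigr => i _.
  by rewrite -sumrN; apply: eq_bigr => p _; rewrite P12 mulNr.
(* ring does not know that half is twice its square. *)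
have hQ : half * - Q = (half * half + half * half) * - Q.
  by rewrite -mulrDr half2 mulr1.
by rewrite hQ; ring.
Qed.

(** O'Neill's formula, for a metric with Levi-Civita connection W in coordinates:
its matrix in the adapted frame is block diagonal, and W is carried to that
frame and identified by uniqueness. *)
Theorem submersion_scalar_curvature (G Gi : 'M[B]_(n + m)) W :
  G *m Gi = 1%:M -> E *m G *m E^T = G' ->
  levi_civita d (fun _ _ => 0) G W ->
  frame_scalar Gi (frame_curvature d (fun _ _ => 0) W) =
  frame_scalar gbi (frame_curvature dh (fun _ _ => 0) wb) - half * half * Q.
Proof.
move=> GGi EG LW; rewrite -/Rb -submersion_scalar.
have EK := hor_frameK; have EiK := hor_coframeK.
have G'i : Gi' *m G' = 1%:M.
  rewrite /Gi' /G' mulmx_block !mulmx0 !mul0mx !addr0 !add0r gbigb.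
  by rewrite (mulmx1C hhi) -scalar_mx_block.
have GiE : Gi = E^T *m Gi' *m E.
  have EiT : E^T *m Ei^T = 1%:M by rewrite -trmx_mul EiK trmx1.
  have G'E : G' *m (Ei^T *m Gi *m Ei) = 1%:M.
    rewrite -EG !mulmxA -(mulmxA _ E^T) EiT mulmx1.
    by rewrite -(mulmxA _ G) GGi mulmx1.
  have <- : Ei^T *m Gi *m Ei = Gi'.
    by rewrite -[LHS]mul1mx -G'i -mulmxA G'E mulmx1.
  by rewrite !mulmxA EiT mul1mx -mulmxA EiK mulmx1.
rewrite (frame_scalarE dC EK EiK _ GiE).
have wE : forall c, frame_connection d E Ei W c = w c.
  apply: (@levi_civita_unique _ _ D C G' Gi' _ w two_reg (mulmx1C G'i)).
  - by rewrite /G' tr_block_mx gbT hT !trmx0.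
  - by have := frame_levi_civita EK EiK LW; rewrite EG.
  - exact: submersion_levi_civita.
have curvE a b : frame_curvature D C (frame_connection d E Ei W) a b = R a b.
  rewrite /R /frame_curvature !wE; congr (_ - _).
  by apply: eq_bigr => e _; rewrite wE.
rewrite /frame_scalar; apply: eq_bigr => b _; apply: eq_bigr => c _.
by congr (_ * _); apply: eq_bigr => a _; rewrite curvE.
Qed.

End Submersion.

(** * Tensor products of matrices *)

Lemma sum_mxvec (B : nmodType) (p q : nat) (F : 'I_(p * q) -> B) :
  \sum_k F k = \sum_i \sum_j F (mxvec_index i j).
Proof.
rewrite pair_bigA (reindex _ (curry_mxvec_bij _ _)) /=.
by apply: eq_bigr => -[].
Qed.

Section TensorMatrix.
Variables (B : comNzRingType) (n : nat).
Implicit Types P Q : 'M[B]_n.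

(** The Kronecker product, on matrices flattened by mxvec. For P the metric and Q
its inverse it is the metric induced on (1,1)-tensors, the upper index of a
tensor being its row. *)
Definition tensor_mx P Q : 'M[B]_(n * n) :=
  \matrix_k mxvec (P^T *m vec_mx (delta_mx 0 k) *m Q).

Lemma tensor_mxE P Q i j c l :
  tensor_mx P Q (mxvec_index i j) (mxvec_index c l) = P i c * Q j l.
Proof.
rewrite mxE mxvecE vec_mx_delta mxE (bigD1 j) //= big1 ?addr0; last first.
  move=> k /negPf kj; rewrite mxE big1 ?mul0r // => m _.
  by rewrite mxE [delta_mx _ _ _ _]mxE kj andbF mulr0.
rewrite mxE (bigD1 i) //= big1 ?addr0; last first.
  by move=> k /negPf ki; rewrite [delta_mx _ _ _ _]mxE ki mulr0.
by rewrite mxE [delta_mx _ _ _ _]mxE !eqxx mulr1.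
Qed.

Lemma tensor_mxP (X Y : 'M[B]_(n * n)) :
  (forall i j c l, X (mxvec_index i j) (mxvec_index c l) =
                   Y (mxvec_index i j) (mxvec_index c l)) -> X = Y.
Proof.
move=> XY; apply/matrixP => a b.
by case/mxvec_indexP: a => i j; case/mxvec_indexP: b => c l.
Qed.

Lemma tensor_mxM P Q P' Q' :
  tensor_mx P Q *m tensor_mx P' Q' = tensor_mx (P *m P') (Q *m Q').
Proof.
apply: tensor_mxP => i j c l; rewrite mxE sum_mxvec tensor_mxE !mxE.
rewrite mulr_suml; apply: eq_bigr => p _; rewrite mulr_sumr.
by apply: eq_bigr => q _; rewrite !tensor_mxE; ring.
Qed.

Lemma tensor_mxT P Q : (tensor_mx P Q)^T = tensor_mx P^T Q^T.
Proof. by apply: tensor_mxP => i j c l; rewrite mxE !tensor_mxE !mxE. Qed.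

Lemma tensor_mx1 : tensor_mx 1%:M 1%:M = 1%:M.
Proof.
by apply/row_matrixP => k; rewrite rowK trmx1 mul1mx mulmx1 vec_mxK row1.
Qed.

Lemma tensor_mx_der (D : derivation B) P Q : map_mx D (tensor_mx P Q) =
  tensor_mx (map_mx D P) Q + tensor_mx P (map_mx D Q).
Proof.
apply: tensor_mxP => i j c l.
by rewrite [LHS]mxE [RHS]mxE !tensor_mxE derM !mxE.
Qed.

End TensorMatrix.

(** * The square of the curvature acting on a (1,1)-tensor *)

(** Minus the curvature operator applied to the (1,1)-tensor t, where K is the
matrix of the operator on vectors, acting on row vectors from the right. *)
Definition curvature_action (B : comNzRingType) n (t K : 'M[B]_n) : 'M[B]_n :=
  t *m K^T - K^T *m t.

(** The inner product of two families of (1,1)-tensors that depend on two further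
lower indices. *)
Definition tensor_contraction (B : comNzRingType) n (g gi : 'M[B]_n)
    (X Y : 'I_n -> 'I_n -> 'I_n -> 'I_n -> B) : B :=
  \sum_i \sum_k \sum_j \sum_l gi i k * gi j l *
    \sum_a \sum_b \sum_c \sum_e X i j a b * (g a c * gi b e) * Y k l c e.

Section CurvatureSquare.
Variables (B : comNzRingType) (n : nat) (g gi t : 'M[B]_n).
Variable Rm : 'I_n -> 'I_n -> 'M[B]_n.
Hypotheses (ggi : g *m gi = 1%:M) (gT : g^T = g).
Let L k l j m := (Rm k l *m g) j m.
Hypothesis anti12 : forall k l j m, L k l j m = - L l k j m.
Hypothesis pair_sym : forall k l j m, L k l j m = L j m k l.

Let O i j : 'M[B]_n := curvature_action t (Rm i j).

(** The two parts of the action, on the lower index of t for U and on the upper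
index for V. *)
Let U i j a b := \sum_m t a m * Rm i j b m.
Let V i j a b := \sum_m Rm i j m a * t m b.

Let giS i j : gi i j = gi j i.
Proof. by rewrite -[in LHS](sym_inverse ggi gT) mxE. Qed.

Let contract := tensor_contraction g gi.

Lemma contract_split : contract O O =
  contract V V + contract U U - (contract U V + contract V U).
Proof.
rewrite /contract /tensor_contraction.
rewrite -!big_split -sumrB; apply: eq_bigr => i _ /=.
rewrite -!big_split -sumrB; apply: eq_bigr => k _ /=.
rewrite -!big_split -sumrB; apply: eq_bigr => j _ /=.
rewrite -!big_split -sumrB; apply: eq_bigr => l _ /=.
rewrite -!mulrDr -mulrBr; congr (_ * _).
rewrite -!big_split -sumrB; apply: eq_bigr => a _ /=.
rewrite -!big_split -sumrB; apply: eq_bigr => b _ /=.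
rewrite -!big_split -sumrB; apply: eq_bigr => c _ /=.
rewrite -!big_split -sumrB; apply: eq_bigr => e _ /=.
have OE i' j' a' b' : O i' j' a' b' = U i' j' a' b' - V i' j' a' b'.
  rewrite /O /curvature_action /U /V !mxE; congr (_ - _);
  by apply: eq_bigr => m _; rewrite mxE.
by rewrite !OE; ring.
Qed.

Let sum4 (F : 'I_n -> 'I_n -> 'I_n -> 'I_n -> B) x :
  x * (\sum_a \sum_b \sum_c \sum_e F a b c e) =
  \sum_a \sum_b \sum_c \sum_e x * F a b c e.
Proof.
rewrite mulr_sumr; apply: eq_bigr => a _; rewrite mulr_sumr.
apply: eq_bigr => b _; rewrite mulr_sumr; apply: eq_bigr => c _.
by rewrite mulr_sumr.
Qed.

Lemma contractC X Y : contract X Y = contract Y X.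
Proof.
rewrite /contract /tensor_contraction.
under eq_bigr do under eq_bigr do under eq_bigr do
  under eq_bigr do rewrite sum4.
under [RHS]eq_bigr do under eq_bigr do under eq_bigr do
  under eq_bigr do rewrite sum4.
rewrite !pair_bigA; apply: (sum_reindex
  (p := fun x => let: (i, k, j, l, a, b, c, e) := x in
        (k, i, l, j, c, e, a, b))
  (q := fun x => let: (k, i, l, j, c, e, a, b) := x in
        (i, k, j, l, a, b, c, e))) => //=;
  move=> [[[[[[[i k] j] l] a] b] c] e] //=.
have -> : g c a = g a c by rewrite -[in LHS]gT mxE.
by rewrite (giS k) (giS l) (giS e); ring.
Qed.

Lemma contract_UU : contract U U =
  \sum_c \sum_d \sum_l \sum_j \sum_h \sum_k \sum_r \sum_v \sum_s \sum_p
    g c d * gi l j * gi h k * gi r v * Rm r l h s * Rm v j k p * t c s * t d p.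
Proof.
transitivity (\sum_r \sum_v \sum_l \sum_j \sum_c \sum_h \sum_d \sum_k
  \sum_s \sum_p
  g c d * gi l j * gi h k * gi r v * Rm r l h s * Rm v j k p * t c s * t d p).
  apply: eq_bigr => r _; apply: eq_bigr => v _; apply: eq_bigr => l _.
  apply: eq_bigr => j _; rewrite sum4; apply: eq_bigr => c _.
  apply: eq_bigr => h _; apply: eq_bigr => d _; apply: eq_bigr => k _.
  rewrite /U !mulr_suml mulr_sumr; apply: eq_bigr => s _.
  rewrite !mulr_sumr; apply: eq_bigr => p _.
  by ring.
rewrite !pair_bigA; apply: (sum_reindex
  (p := fun x => let: (r, v, l, j, c, h, d, k, s, p) := x in
        (c, d, l, j, h, k, r, v, s, p))
  (q := fun x => let: (c, d, l, j, h, k, r, v, s, p) := x in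
        (r, v, l, j, c, h, d, k, s, p))) => //=;
  move=> [[[[[[[[[r v] l] j] c] h] d] k] s] p] //=.
Qed.

(** Summing over two upper indices with g amounts to lowering both and summing
with the inverse of g. *)
Let RgR (X Y : 'M[B]_n) : X *m g *m Y^T = (X *m g) *m gi *m (Y *m g)^T.
Proof. by rewrite trmx_mul gT !mulmxA -(mulmxA X g gi) ggi mulmx1. Qed.

Let LE k l j m : \sum_s Rm k l j s * g s m = L k l j m.
Proof. by rewrite /L mxE. Qed.

(** Lowering the upper index of the curvature by RgR and exchanging the two pairs
of indices puts the indices of the operator last, as in the statement. *)
Lemma contract_VV : contract V V =
  \sum_a \sum_b \sum_h \sum_k \sum_l \sum_j \sum_v \sum_r \sum_s \sum_p
    gi a b * gi h k * gi l j * gi v r * L s l h v * L p j k r * t s a * t p b.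
Proof.
transitivity (\sum_h \sum_k \sum_v \sum_r \sum_a \sum_b \sum_s \sum_p
  \sum_l \sum_j
    gi a b * gi h k * gi l j * gi v r * L s l h v * L p j k r * t s a * t p b).
  apply: eq_bigr => h _; apply: eq_bigr => k _; apply: eq_bigr => v _.
  apply: eq_bigr => r _.
  transitivity (gi h k * gi v r * \sum_a \sum_b \sum_s \sum_p
    gi a b * t s a * t p b * (Rm h v *m g *m (Rm k r)^T) s p).
    congr (_ * _); rewrite exchange_big; apply: eq_bigr => a _ /=.
    under eq_bigr => x _ do rewrite exchange_big /=.
    rewrite exchange_big; apply: eq_bigr => b _ /=.
    transitivity (\sum_x \sum_y \sum_s \sum_p
      Rm h v s x * t s a * (g x y * gi a b) * (Rm k r p y * t p b)).
      apply: eq_bigr => x _; apply: eq_bigr => y _.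
      by rewrite /V !mulr_suml; apply: eq_bigr => s _; rewrite mulr_sumr.
    transitivity (\sum_s \sum_p \sum_y \sum_x
      Rm h v s x * t s a * (g x y * gi a b) * (Rm k r p y * t p b)).
      rewrite !pair_bigA; apply: (sum_reindex
        (p := fun x => let: (x, y, s, p) := x in
              (s, p, y, x))
        (q := fun x => let: (s, p, y, x) := x in
              (x, y, s, p))) => //=;
        move=> [[[x y] s] p] //=.
    apply: eq_bigr => s _; apply: eq_bigr => p _.
    rewrite [in RHS]mxE mulr_sumr; apply: eq_bigr => y _.
    rewrite [(Rm h v *m g) _ _]mxE mulr_suml mulr_sumr; apply: eq_bigr => x _.
    by rewrite [_^T _ _]mxE; ring.
  rewrite sum4; apply: eq_bigr => a _; apply: eq_bigr => b _.
  apply: eq_bigr => s _; apply: eq_bigr => p _.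
  rewrite RgR [((_ *m gi) *m _) _ _]mxE !mulr_sumr.
  transitivity (\sum_j \sum_l gi h k * gi v r * (gi a b * t s a * t p b *
      (L h v s l * gi l j * L k r p j))).
    apply: eq_bigr => j _.
    rewrite [((_ *m _) *m gi) _ _]mxE mulr_suml !mulr_sumr.
    by apply: eq_bigr => l _; rewrite [_^T _ _]mxE.
  rewrite exchange_big /=; apply: eq_bigr => l _; apply: eq_bigr => j _.
  by rewrite (pair_sym s l) (pair_sym p j); ring.
rewrite !pair_bigA; apply: (sum_reindex
  (p := fun x => let: (h, k, v, r, a, b, s, p, l, j) := x in
        (a, b, h, k, l, j, v, r, s, p))
  (q := fun x => let: (a, b, h, k, l, j, v, r, s, p) := x in
        (h, k, v, r, a, b, s, p, l, j))) => //=;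
  move=> [[[[[[[[[h k] v] r] a] b] s] p] l] j] //=.
Qed.

(** The metric lowers the upper index of the second curvature; exchanging pairs
and reversing both of them produces the index pattern of the statement. *)
Lemma contract_UV : contract U V =
  \sum_c \sum_p \sum_r \sum_h \sum_b \sum_s
    Rm c p r h * (\sum_e \sum_z gi r e * gi b z * Rm h e z s) * t c s * t p b.
Proof.
transitivity (\sum_h \sum_m \sum_e \sum_r \sum_c \sum_z \sum_b \sum_s \sum_p
  gi h m * gi e r * gi b z * t c s * Rm h e z s * L m r p c * t p b).
  apply: eq_bigr => h _; apply: eq_bigr => m _; apply: eq_bigr => e _.
  apply: eq_bigr => r _.
  rewrite mulr_sumr; apply: eq_bigr => c _.
  rewrite mulr_sumr; apply: eq_bigr => z _.
  rewrite exchange_big mulr_sumr; apply: eq_bigr => b _ /=.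
  transitivity (\sum_s \sum_p \sum_x
    gi h m * gi e r * gi b z * t c s * Rm h e z s * t p b *
    (Rm m r p x * g x c)).
    transitivity (\sum_x \sum_s \sum_p
      gi h m * gi e r * gi b z * t c s * Rm h e z s * t p b *
      (Rm m r p x * g x c)).
      rewrite mulr_sumr; apply: eq_bigr => x _.
      rewrite /U /V !mulr_suml mulr_sumr; apply: eq_bigr => s _.
      rewrite !mulr_sumr; apply: eq_bigr => p _.
      rewrite (giS z b) [g c x](_ : _ = g x c); first by ring.
      by rewrite -[in LHS]gT mxE.
    rewrite exchange_big /=; apply: eq_bigr => s _.
    by rewrite exchange_big.
  apply: eq_bigr => s _; apply: eq_bigr => p _.
  by rewrite -mulr_sumr LE; ring.
transitivity (\sum_c \sum_p \sum_r \sum_h \sum_b \sum_s \sum_e \sum_z \sum_m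
  gi h m * gi e r * gi b z * t c s * Rm h e z s * L m r p c * t p b).
  rewrite !pair_bigA; apply: (sum_reindex
    (p := fun x => let: (h, m, e, r, c, z, b, s, p) := x in
          (c, p, r, h, b, s, e, z, m))
    (q := fun x => let: (c, p, r, h, b, s, e, z, m) := x in
          (h, m, e, r, c, z, b, s, p))) => //=;
    move=> [[[[[[[[h m] e] r] c] z] b] s] p] //=.
apply: eq_bigr => c _; apply: eq_bigr => p _; apply: eq_bigr => r _.
apply: eq_bigr => h _; apply: eq_bigr => b _; apply: eq_bigr => s _.
rewrite mulr_sumr !mulr_suml; apply: eq_bigr => e _.
rewrite mulr_sumr !mulr_suml; apply: eq_bigr => z _.
have -> : Rm c p r h = \sum_m L c p r m * gi m h.
  transitivity ((Rm c p *m g *m gi) r h); last by rewrite mxE.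
  by rewrite -mulmxA ggi mulmx1.
rewrite !mulr_suml; apply: eq_bigr => m _.
have -> : L m r p c = L c p r m.
  rewrite (pair_sym m r) (anti12 p c) (pair_sym c p m r) (anti12 m r c p).
  by rewrite (pair_sym r m) opprK.
by rewrite (giS m h) (giS r e); ring.
Qed.

Lemma curvature_action_square : contract O O =
  (\sum_a \sum_b \sum_h \sum_k \sum_l \sum_j \sum_v \sum_r \sum_s \sum_p
    gi a b * gi h k * gi l j * gi v r * L s l h v * L p j k r * t s a * t p b)
  + (\sum_c \sum_d \sum_l \sum_j \sum_h \sum_k \sum_r \sum_v \sum_s \sum_p
    g c d * gi l j * gi h k * gi r v * Rm r l h s * Rm v j k p * t c s * t d p)
  - 2%:R * (\sum_c \sum_p \sum_r \sum_h \sum_b \sum_s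
    Rm c p r h * (\sum_e \sum_z gi r e * gi b z * Rm h e z s)
      * t c s * t p b).
Proof.
by rewrite contract_split (contractC V U) contract_VV contract_UU contract_UV;
  ring.
Qed.

End CurvatureSquare.

(** * The bundle of (1,1)-tensors over a ring of functions *)

Section TensorBundleAlgebra.
Variables (B : comNzRingType) (n : nat).
Variable d : 'I_(n + n * n) -> derivation B.
Hypothesis dC : forall i j x, d i (d j x) = d j (d i x).

Let dh i := d (lshift (n * n) i).
Let dv a := d (rshift n a).

Variables (g gi : 'M[B]_n) (Gam : 'I_n -> 'M[B]_n) (f fi half : B).
Hypotheses (ggi : g *m gi = 1%:M) (gT : g^T = g).
Hypotheses (half2 : half + half = 1) (ffi : f * fi = 1).
Hypothesis GamP : levi_civita dh (fun _ _ => 0) g Gam.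
Hypothesis dv_g : forall a, map_mx (dv a) g = 0.
Hypothesis dv_Gam : forall a i, map_mx (dv a) (Gam i) = 0.
Hypothesis dv_f : forall a, dv a f = 0.

Variable t : 'M[B]_n.
Hypothesis dh_t : forall s i j, dh s (t i j) = 0.
Hypothesis dv_t : forall k l i j,
  dv (mxvec_index k l) (t i j) = ((i == k) && (j == l))%:R.

Let Rm := frame_curvature dh (fun _ _ => 0) Gam.

Let gidv a : map_mx (dv a) gi = 0.
Proof.
by rewrite (map_mx_derV _ (mulmx1C ggi) ggi) dv_g mulmx0 mul0mx oppr0.
Qed.

Let fidv a : dv a fi = 0.
Proof.
have := derM (dv a) f fi; rewrite ffi der1 dv_f mul0r add0r => e.
by rewrite -[LHS]mul1r -ffi mulrAC -e mul0r.
Qed.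

(** The fibre components, at t, of the horizontal lift of the s-th coordinate
field. *)
Definition tensor_lift s : 'M[B]_n := t *m (Gam s)^T - (Gam s)^T *m t.
Let N := tensor_lift.

Definition lift_mx : 'M[B]_(n, n * n) := \matrix_s mxvec (N s).
Let H := lift_mx.

Lemma lift_mxE s i j : H s (mxvec_index i j) = N s i j.
Proof. by rewrite mxE mxvecE. Qed.

Let dv_tm k l p q (A : 'M[B]_n) : map_mx (dv (mxvec_index k l)) A = 0 ->
  (dv (mxvec_index k l) ((t *m A^T) p q) = (p == k)%:R * A q l) *
  (dv (mxvec_index k l) ((A^T *m t) p q) = A k p * (q == l)%:R).
Proof.
move=> dA; have dAE i j : dv (mxvec_index k l) (A i j) = 0.
  by have /matrixP/(_ i j) := dA; rewrite !mxE.
split; rewrite mxE raddf_sum /=.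
  rewrite (bigD1 l) //= big1 ?addr0.
    by rewrite derM mxE dAE mulr0 addr0 dv_t eqxx andbT.
  move=> m /negPf ml; rewrite derM mxE dAE mulr0 addr0 dv_t ml andbF.
  by rewrite mul0r.
rewrite (bigD1 k) //= big1 ?addr0.
  by rewrite derM mxE dAE mul0r add0r dv_t eqxx.
by move=> m /negPf ml; rewrite derM mxE dAE mul0r add0r dv_t ml mulr0.
Qed.

(** The lift is linear in t, and its derivative in the fibre directions is the
connection that Gam induces on (1,1)-tensors. *)
Lemma fibre_connection_tensor s : fibre_connection d H s =
  tensor_mx (Gam s) 1%:M - tensor_mx 1%:M (Gam s)^T.
Proof.
apply: tensor_mxP => i j c l; rewrite [LHS]mxE -/(dv _) lift_mxE.
have mxEs (X Y : 'M[B]_(n * n)) a b : (X - Y) a b = X a b - Y a b.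
  by rewrite !mxE.
rewrite mxEs !tensor_mxE /N /tensor_lift.
have -> (X Y : 'M[B]_n) : (X - Y) c l = X c l - Y c l by rewrite !mxE.
rewrite raddfB /= !dv_tm // opprB !mxE.
by rewrite [j == l]eq_sym [i == c]eq_sym.
Qed.

Let h := tensor_mx g gi.

(** Both g and its inverse are parallel for Gam. *)
Lemma tensor_metric_parallel s : map_mx (dh s) h =
  fibre_connection d H s *m h + h *m (fibre_connection d H s)^T.
Proof.
have [cg _] := GamP.
rewrite fibre_connection_tensor linearB /= !tensor_mxT !trmx1 trmxK.
rewrite mulmxBl mulmxBr !tensor_mxM !mul1mx !mulmx1 tensor_mx_der.
have -> : map_mx (dh s) gi = - ((Gam s)^T *m gi + gi *m Gam s).
  rewrite (map_mx_derV _ (mulmx1C ggi) ggi) cg mulmxDr mulmxDl; congr (- _).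
  rewrite addrC -!mulmxA (mulmxA gi g) (mulmx1C ggi) mul1mx.
  by rewrite ggi mulmx1.
rewrite cg; apply: tensor_mxP => i j c l.
have mxEs (X1 X2 X3 X4 : 'M[B]_(n * n)) a b :
  (X1 - X2 + (X3 - X4)) a b = X1 a b - X2 a b + (X3 a b - X4 a b).
  by rewrite !mxE.
rewrite mxEs [LHS]mxE !tensor_mxE.
by move: (_ *m _) (_ *m _) (_ *m _) (_ *m _) => *; rewrite !mxE; ring.
Qed.

Let D s := frame_der d (hor_frame H) (lshift (n * n) s).

Let DE s x : D s x = dh s x + \sum_b H s b * dv b x.
Proof. exact: hor_frame_derl. Qed.

Let D_t s : map_mx (D s) t = N s.
Proof.
apply/matrixP => i j; rewrite mxE DE dh_t add0r sum_mxvec.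
rewrite (bigD1 i) //= (bigD1 j) //= dv_t !eqxx mulr1 lift_mxE.
rewrite big1 ?addr0 => [|l /negPf lj]; last first.
  by rewrite dv_t [j == l]eq_sym lj andbF mulr0.
rewrite big1 ?addr0 // => k /negPf ki; apply: big1 => l _.
by rewrite dv_t [i == k]eq_sym ki mulr0.
Qed.

Let D_base s p q (A : 'M[B]_(p, q)) : (forall a, map_mx (dv a) A = 0) ->
  map_mx (D s) A = map_mx (dh s) A.
Proof.
move=> dA; apply/matrixP => i j; rewrite !mxE DE big1 ?addr0 // => a _.
by have /matrixP/(_ i j) := dA a; rewrite !mxE => ->; rewrite mulr0.
Qed.

Let O s r := curvature_action t (Rm s r).

(** A horizontal field acts by dh on functions of the base, and sends t to
tensor_lift. Applied to tensor_lift itself, the derivatives and the quadratic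
terms in Gam combine to the curvature of Gam. *)
Lemma hor_curvature_tensor s r i j :
  hor_curvature d H s r (mxvec_index i j) = O s r i j.
Proof.
rewrite mxE -!DE !lift_mxE.
have DN a b : map_mx (D a) (N b) =
    t *m (map_mx (dh a) (Gam b))^T - (map_mx (dh a) (Gam b))^T *m t
    + (t *m (Gam a)^T - (Gam a)^T *m t) *m (Gam b)^T
    - (Gam b)^T *m (t *m (Gam a)^T - (Gam a)^T *m t).
  rewrite /N /tensor_lift raddfB /= !map_mx_derM D_t -map_trmx D_base //.
  by rewrite opprD [X in X + _]addrC addrACA addrA.
have mxEs (D1 D2 : derivation B) (X Y : 'M[B]_n) :
  D1 (X i j) - D2 (Y i j) = (map_mx D1 X - map_mx D2 Y) i j by rewrite !mxE.
rewrite mxEs !DN /O /curvature_action /Rm frame_curvature0.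
congr (fun_of_matrix _ i j).
have trE (X1 X2 X3 X4 : 'M[B]_n) :
  (X1 - X2 + X3 - X4)^T = X1^T - X2^T + X3^T - X4^T.
  by apply/matrixP => a b; rewrite !mxE.
rewrite !trE !trmx_mul.
move: (map_mx _ (Gam r))^T (map_mx _ (Gam s))^T (Gam r)^T (Gam s)^T.
move=> X Y P Q.
rewrite !(mulmxDl, mulmxDr, mulmxBl, mulmxBr, mulmxN, mulNmx, mulmxA).
move: (t *m X) (t *m Y) (X *m t) (Y *m t) (t *m P *m Q) (t *m Q *m P).
move: (P *m t *m Q) (Q *m t *m P) (P *m Q *m t) (Q *m P *m t).
move=> x1 x2 x3 x4 x5 x6 x7 x8 x9 x10.
by apply/matrixP => a b; rewrite !mxE; ring.
Qed.

Let S := conformal_shift dh g gi half f fi.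

Let hor_curvature_square : curvature_square d (fi *: gi) h H =
  fi * fi * tensor_contraction g gi O O.
Proof.
rewrite /tensor_contraction mulr_sumr; apply: eq_bigr => i _.
rewrite mulr_sumr; apply: eq_bigr => k _.
rewrite mulr_sumr; apply: eq_bigr => j _.
rewrite mulr_sumr; apply: eq_bigr => l _.
have -> : (hor_curvature d H i *m h *m (hor_curvature d H k)^T) j l =
    \sum_a \sum_b \sum_c \sum_e O i j a b * (g a c * gi b e) * O k l c e.
  transitivity (\sum_x \sum_y hor_curvature d H i j x * h x y *
                              hor_curvature d H k l y).
    rewrite mxE exchange_big; apply: eq_bigr => y _.
    rewrite [X in X * _]mxE mulr_suml; apply: eq_bigr => x _.
    by rewrite [_^T _ _]mxE.
  rewrite sum_mxvec; apply: eq_bigr => a _; apply: eq_bigr => b _.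
  rewrite sum_mxvec; apply: eq_bigr => c _; apply: eq_bigr => e _.
  by rewrite !hor_curvature_tensor tensor_mxE.
by rewrite [(fi *: gi) i k]mxE [(fi *: gi) j l]mxE; ring.
Qed.

(** Here G is the rescaled Sasaki type metric, given by its blocks in the adapted
frame, and W its Levi-Civita connection. *)
Theorem tensor_bundle_scalar (G Gi : 'M[B]_(n + n * n)) W :
  G *m Gi = 1%:M ->
  hor_frame H *m G *m (hor_frame H)^T = block_mx (f *: g) 0 0 h ->
  levi_civita d (fun _ _ => 0) G W ->
  frame_scalar Gi (frame_curvature d (fun _ _ => 0) W) =
  fi * frame_scalar gi Rm + fi * \sum_l \sum_j gi l j *
    (\sum_r cov_shift dh g gi Gam half f fi r l j r
     - \sum_r cov_shift dh g gi Gam half f fi l r j r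
     + \sum_r \sum_s S r s r * S l j s - \sum_r \sum_s S l s r * S r j s)
  - half * half * (fi * fi * tensor_contraction g gi O O).
Proof.
move=> GGi EG LW.
have dv_dhf a i : dv a (dh i f) = 0 by rewrite dC dv_f raddf0.
have dv_S a i : map_mx (dv a) (S i) = 0.
  have gE j k : dv a (g j k) = 0.
    by have /matrixP/(_ j k) := dv_g a; rewrite !mxE.
  have giE j k : dv a (gi j k) = 0.
    by have /matrixP/(_ j k) := gidv a; rewrite !mxE.
  have sumE j : dv a (\sum_m gi j m * dh m f) = 0.
    rewrite raddf_sum big1 //= => m _; rewrite derM giE dv_dhf.
    by rewrite mulr0 mul0r addr0.
  apply/matrixP => j k; rewrite !mxE.
  rewrite derM derM (der_half _ half2) fidv raddfB raddfD /= !derM.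
  by rewrite sumE gE !dv_dhf !der_nat; ring.
rewrite -(conformal_scalar gi GamP) -hor_curvature_square.
apply: (submersion_scalar_curvature (gb := f *: g) (hi := tensor_mx gi g)
          dC half2 _ _ _ _ _ _ _ _ _ GGi EG LW).
- by rewrite -scalemxAl -scalemxAr scalerA ffi scale1r.
- by rewrite linearZ /= gT.
- by rewrite tensor_mxM ggi (mulmx1C ggi) tensor_mx1.
- by rewrite tensor_mxT gT (sym_inverse ggi gT).
- by move=> a; rewrite -/(dv a) map_mx_derZ dv_f scale0r dv_g scaler0 addr0.
- move=> a; rewrite -/(dv a) tensor_mx_der dv_g gidv.
  apply: tensor_mxP => i j c l; rewrite mxE !tensor_mxE !mxE.
  by rewrite mul0r mulr0 addr0.
- exact: tensor_metric_parallel.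
- exact: conformal_levi_civita.
- by move=> a i; rewrite map_mxD -/(dv a) dv_Gam dv_S addr0.
Qed.

End TensorBundleAlgebra.

(** * Symmetry of second derivatives *)

Section Schwarz.
Variables (R : realType) (V : normedModType R).
Implicit Types (F : V -> R) (u v x y : V).

Lemma is_derive_line F y u (s : R) : derivable F (s *: u + y) u ->
  is_derive s 1 (fun s => F (s *: u + y)) ('D_u F (s *: u + y)).
Proof.
have E : (fun h : R => h^-1 *: (F ((h *: 1 + s) *: u + y) - F (s *: u + y))) =
         (fun h : R => h^-1 *: (F (h *: u + (s *: u + y)) - F (s *: u + y))).
  by apply/funext => h; rewrite [h *: 1]mulr1 scalerDl addrA.
move=> dF; split; first by move: dF; rewrite /derivable -E.
by rewrite /derive -E.
Qed.

Lemma mvt_segment_derive (phi dphi : R -> R) (h : R) : 0 <= h ->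
  (forall s, 0 <= s <= h -> is_derive s 1 phi (dphi s)) ->
  exists2 s, 0 <= s <= h & phi h - phi 0 = h * dphi s.
Proof.
move=> h0 dE.
have dE' s : s \in `[0, h]%R -> is_derive s 1 phi (dphi s).
  by rewrite in_itv /=; exact: dE.
have cphi : {within `[0, h], continuous phi}.
  by apply: derivable_within_continuous => s /dE' [].
have dE'' s : s \in `]0, h[%R -> is_derive s 1 phi (dphi s).
  by move=> /subset_itv_oo_cc; exact: dE'.
have [s sI E] := MVT_segment h0 dE'' cphi.
exists s; first by rewrite in_itv /= in sI.
by rewrite E subr0 mulrC.
Qed.

(** The mean value theorem along u, then along v. *)
Lemma second_difference F x u v (h : R) : 0 <= h ->
  (forall s r, 0 <= s <= h -> 0 <= r <= h ->
     derivable F (s *: u + (r *: v + x)) u /\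
     derivable ('D_u F) (r *: v + (s *: u + x)) v) ->
  exists s r, [/\ 0 <= s <= h, 0 <= r <= h &
    F (h *: u + (h *: v + x)) - F (h *: u + x) - (F (h *: v + x) - F x) =
    h * (h * 'D_v ('D_u F) (r *: v + (s *: u + x)))].
Proof.
move=> h0 dF; have hh : 0 <= h <= h by rewrite h0 lexx.
have h00 : 0 <= (0 : R) <= h by rewrite lexx h0.
have [s sh|s sh Es] := @mvt_segment_derive
  (fun s => F (s *: u + (h *: v + x)) - F (s *: u + x))
  (fun s => 'D_u F (s *: u + (h *: v + x)) - 'D_u F (s *: u + x)) h h0.
  have [d1 _] := dF _ _ sh hh; have [d0 _] := dF _ _ sh h00.
  rewrite scale0r add0r in d0.
  by apply: is_deriveB; exact: is_derive_line.
have [r rh|r rh Er] := @mvt_segment_derive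
  (fun r => 'D_u F (r *: v + (s *: u + x)))
  (fun r => 'D_v ('D_u F) (r *: v + (s *: u + x))) h h0.
  by have [_ d1] := dF _ _ sh rh; exact: is_derive_line.
exists s, r; split => //.
move: Es Er; rewrite !scale0r !add0r => -> <-.
by rewrite addrCA.
Qed.

Lemma small_box x u v (N : set V) : nbhs x N ->
  exists2 h : R, 0 < h &
    forall s r, 0 <= s <= h -> 0 <= r <= h -> N (s *: u + (r *: v + x)).
Proof.
move=> /nbhs_ballP[e /= e0 eN]; pose c := `|u| + `|v| + 1.
have c0 : 0 < c by rewrite ltr_wpDl // addr_ge0.
(* The factor 1/2 makes the final bound strict. *)
exists (e / c / 2); first by rewrite !divr_gt0.
move=> s r /andP[s0 sh] /andP[r0 rh]; apply: eN; rewrite -ball_normE /=.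
rewrite addrA opprD addrCA subrr addr0 normrN.
have h0 : 0 < e / c / 2 by rewrite !divr_gt0.
have := ler_normD (s *: u) (r *: v).
rewrite !normrZ (ger0_norm s0) (ger0_norm r0).
move=> /le_lt_trans; apply.
apply: (@le_lt_trans _ _ (e / c / 2 * c)).
  rewrite /c !mulrDr mulr1 -[leLHS]addr0 lerD ?(ltW h0) //.
  by rewrite lerD // ler_wpM2r.
by rewrite mulrAC divfK ?gt_eqF // ltr_pdivrMr // ltr_pMr // ltr1n.
Qed.

Lemma half_distance (a b c : R) :
  `|a - c| < `|a - b| / 2 -> `|b - c| < `|a - b| / 2 -> False.
Proof.
move=> ac bc; have := ltrD ac bc; rewrite -splitr (distrC b).
by move=> /(le_lt_trans (ler_distD c a b)); rewrite ltxx.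
Qed.

(** The second difference over a parallelogram of size h at x equals h^2 times
each of the two mixed derivatives, taken at two points of the parallelogram. If
the mixed derivatives differed at x, a small parallelogram would separate them
by continuity. *)
Lemma schwarz F x u v (D : set V) : open D -> D x ->
  (forall y, D y -> derivable F y u) -> (forall y, D y -> derivable F y v) ->
  (forall y, D y -> derivable ('D_u F) y v) ->
  (forall y, D y -> derivable ('D_v F) y u) ->
  {for x, continuous ('D_v ('D_u F))} ->
  {for x, continuous ('D_u ('D_v F))} ->
  'D_v ('D_u F) x = 'D_u ('D_v F) x.
Proof.
move=> oD Dx du dv dvu duv cvu cuv.
apply/eqP; apply: contraT => ne.
pose e := `|'D_v ('D_u F) x - 'D_u ('D_v F) x| / 2.
have e0 : 0 < e by rewrite divr_gt0 // normr_gt0 subr_eq0.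
pose N := D `&` [set y | `|'D_v ('D_u F) x - 'D_v ('D_u F) y| < e]
            `&` [set y | `|'D_u ('D_v F) x - 'D_u ('D_v F) y| < e].
have nN : nbhs x N.
  apply: filterI; last by have /cvgrPdist_lt/(_ _ e0) := cuv.
  apply: filterI; first exact: open_nbhs_nbhs.
  by have /cvgrPdist_lt/(_ _ e0) := cvu.
have [h h0 hN] := small_box u v nN.
have [s rs|s [r [sh rh E1]]] := @second_difference F x u v h (ltW h0).
  move=> sh rh; have [[Dp _] _] := hN _ _ sh rh; split; first exact: du.
  by rewrite addrCA; exact: dvu.
have [s' rs'|s' [r' [sh' rh' E2]]] := @second_difference F x v u h (ltW h0).
  move=> sh' rh'; have [[Dp _] _] := hN _ _ rh' sh'; split; last exact: duv.
  by rewrite addrCA; exact: dv.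
have E : 'D_v ('D_u F) (r *: v + (s *: u + x)) =
         'D_u ('D_v F) (r' *: u + (s' *: v + x)).
  apply: (mulfI (lt0r_neq0 h0)); apply: (mulfI (lt0r_neq0 h0)).
  apply: (etrans (esym E1)); apply: (etrans _ E2).
  by rewrite (addrCA (h *: v)); ring.
have [[_ /= lt1] _] := hN _ _ sh rh; have [_ /= lt2] := hN _ _ rh' sh'.
rewrite addrCA E in lt1.
by case: (half_distance lt1 lt2).
Qed.

End Schwarz.

(** * Functions of class C^k on open sets *)

Section SmoothCalculus.
Variables (R : realType) (n : nat) (D : set 'rV[R]_n).
Hypothesis oD : open D.
Implicit Types (F G : 'rV[R]_n -> R) (x : 'rV[R]_n).

Definition partially_derivable F :=
  forall i x, D x -> derivable F x (delta_mx 0 i).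

Lemma eq_on_near F G x : (forall y, D y -> F y = G y) -> D x ->
  {near x, F =1 G}.
Proof.
move=> FG Dx; have nD : nbhs x D by exact: open_nbhs_nbhs.
by apply: filterS nD => y; exact: FG.
Qed.

Lemma partial_ext F G i x : (forall y, D y -> F y = G y) -> D x ->
  partial i F x = partial i G x.
Proof. by move=> FG Dx; apply: near_eq_derive; exact: eq_on_near. Qed.

Lemma derivable_ext F G v x : (forall y, D y -> F y = G y) -> D x ->
  derivable F x v -> derivable G x v.
Proof. by move=> FG Dx; apply: near_eq_derivable; exact: eq_on_near. Qed.

Lemma continuous_in F : {in D, continuous F} <->
  forall x, D x -> {for x, continuous F}.
Proof.
split=> cF x; first by move=> Dx; apply: cF; rewrite inE.
by rewrite inE; exact: cF.
Qed.

Lemma continuous_ext F G : (forall y, D y -> F y = G y) ->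
  {in D, continuous F} -> {in D, continuous G}.
Proof.
move=> FG /continuous_in cF; apply/continuous_in => x Dx.
suff : G y @[y --> x] --> F x by rewrite (FG x Dx).
apply: cvg_trans (cF x Dx).
exact: (near_eq_cvg (FF := nbhs_filter x) (eq_on_near FG Dx)).
Qed.

Lemma Ck_ext k F G : (forall y, D y -> F y = G y) -> Ck k D F -> Ck k D G.
Proof.
elim: k F G => [|k IH] F G FG [cF dF]; split=> //.
- exact: continuous_ext cF.
- exact: continuous_ext cF.
move=> i; have [dFi CFi] := dF i; split=> [x Dx|].
  exact: derivable_ext (dFi x Dx).
by apply: IH CFi => y Dy; exact: partial_ext.
Qed.

Lemma Ck_continuous k F : Ck k D F -> {in D, continuous F}.
Proof. by case: k => [|k] []. Qed.

Lemma CkS k F : Ck k.+1 D F -> Ck k D F.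
Proof.
elim: k F => [|k IH] F [cF dF]; split=> // i.
by have [dFi CFi] := dF i; split=> //; exact: IH.
Qed.

Lemma Ck_partial k F i : Ck k.+1 D F -> Ck k D (partial i F).
Proof. by case=> _ /(_ i)[]. Qed.

Lemma Ck_derivable k F : Ck k.+1 D F -> partially_derivable F.
Proof. by move=> [_ dF] i x Dx; case: (dF i) => /(_ x Dx). Qed.

Lemma Ck_intro k F : {in D, continuous F} -> partially_derivable F ->
  (forall i, Ck k D (partial i F)) -> Ck k.+1 D F.
Proof. by move=> cF dF CF; split=> // i; split=> // x; exact: dF. Qed.

Lemma Ck_cst k (c : R) : Ck k D (fun=> c).
Proof.
elim: k c => [|k IH] c.
  by split=> //; apply/continuous_in => x _; exact: cst_continuous.
apply: Ck_intro => [|i x _|i].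
- by apply/continuous_in => x _; exact: cst_continuous.
- exact: derivable_cst.
- by apply: Ck_ext (IH 0) => y _; rewrite /partial derive_cst.
Qed.

Lemma Ck_add k F G : Ck k D F -> Ck k D G -> Ck k D (fun x => F x + G x).
Proof.
have cD F' G' : {in D, continuous F'} -> {in D, continuous G'} ->
    {in D, continuous (fun x => F' x + G' x)}.
  move=> /continuous_in cF /continuous_in cG; apply/continuous_in => x Dx.
  exact: (continuousD (cF x Dx) (cG x Dx)).
elim: k F G => [|k IH] F G CF CG.
  by split=> //; apply: cD; [exact: Ck_continuous CF | exact: Ck_continuous CG].
have dF := Ck_derivable CF; have dG := Ck_derivable CG.
apply: Ck_intro => [|i x Dx|i].
- by apply: cD; [exact: Ck_continuous CF | exact: Ck_continuous CG].
- by apply: derivableD; [exact: dF | exact: dG].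
- apply: Ck_ext (IH _ _ (Ck_partial i CF) (Ck_partial i CG)) => y Dy.
  by rewrite /partial -deriveD //; [exact: dF | exact: dG].
Qed.

Lemma Ck_mul k F G : Ck k D F -> Ck k D G -> Ck k D (fun x => F x * G x).
Proof.
have cM F' G' : {in D, continuous F'} -> {in D, continuous G'} ->
    {in D, continuous (fun x => F' x * G' x)}.
  move=> /continuous_in cF /continuous_in cG; apply/continuous_in => x Dx.
  exact: (continuousM (cF x Dx) (cG x Dx)).
elim: k F G => [|k IH] F G CF CG.
  by split=> //; apply: cM; [exact: Ck_continuous CF | exact: Ck_continuous CG].
have dF := Ck_derivable CF; have dG := Ck_derivable CG.
apply: Ck_intro => [|i x Dx|i].
- by apply: cM; [exact: Ck_continuous CF | exact: Ck_continuous CG].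
- by apply: derivableM; [exact: dF | exact: dG].
- have C1 := IH _ _ (CkS CF) (Ck_partial i CG).
  have C2 := IH _ _ (CkS CG) (Ck_partial i CF).
  apply: Ck_ext (Ck_add C1 C2) => y Dy.
  by rewrite /partial -deriveM //; [exact: dF | exact: dG].
Qed.

Lemma Ck_inv k F : (forall x, D x -> F x != 0) -> Ck k D F ->
  Ck k D (fun x => (F x)^-1).
Proof.
move=> F0.
have cV : {in D, continuous F} -> {in D, continuous (fun x => (F x)^-1)}.
  move=> /continuous_in cF; apply/continuous_in => x Dx.
  exact: (continuousV (F0 x Dx) (cF x Dx)).
elim: k => [|k IH] CF.
  by split=> //; apply: cV; exact: Ck_continuous CF.
have dF := Ck_derivable CF.
apply: Ck_intro => [|i x Dx|i].
- by apply: cV; exact: Ck_continuous CF.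
- by apply: derivableV; [exact: F0 | exact: dF].
- have CV := IH (CkS CF).
  have := Ck_mul (Ck_mul CV CV) (Ck_mul (Ck_cst k (-1)) (Ck_partial i CF)).
  apply: Ck_ext => y Dy.
  rewrite /partial deriveV //; [|exact: F0|exact: dF].
  by rewrite mulN1r mulrN [RHS]mulNr expr2 invfM.
Qed.

Lemma derive_coord i (x v : 'rV[R]_n) :
  is_derive x v (fun y : 'rV[R]_n => y 0 i) (v 0 i).
Proof.
have d : differentiable (fun y : 'rV[R]_n => y 0 i : R) x.
  exact: differentiable_coord.
split; first exact: diff_derivable.
rewrite /derive; apply/cvg_lim => //.
apply: cvg_near_cst; near=> h.
rewrite /= !mxE addrK [_ *: _]mulrA mulVf ?mul1r //.
near: h; exact: nbhs_dnbhs_neq.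
Unshelve. all: by end_near. Qed.

Lemma Ck_coord k i : Ck k D (fun x => x 0 i).
Proof.
have cc : {in D, continuous (fun x : 'rV[R]_n => x 0 i)}.
  by apply/continuous_in => x _; exact: coord_continuous.
case: k => [|k]; first by split.
apply: Ck_intro => // [j x _|j].
  by case: (derive_coord i x (delta_mx 0 j)).
apply: Ck_ext (Ck_cst k ((delta_mx 0 j : 'rV[R]_n) 0 i)) => y _.
by rewrite /partial; case: (derive_coord i y (delta_mx 0 j)).
Qed.

Lemma partialC F i j x : smooth_on D F -> D x ->
  partial i (partial j F) x = partial j (partial i F) x.
Proof.
move=> sF Dx; have C2 := sF 2%N; have C1i := Ck_partial i C2.
have C1j := Ck_partial j C2.
apply: (schwarz oD Dx).
- by move=> y Dy; exact: Ck_derivable C2 _ _ Dy.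
- by move=> y Dy; exact: Ck_derivable C2 _ _ Dy.
- by move=> y Dy; exact: Ck_derivable C1j _ _ Dy.
- by move=> y Dy; exact: Ck_derivable C1i _ _ Dy.
- by have /continuous_in := Ck_continuous (Ck_partial i C1j); apply.
- by have /continuous_in := Ck_continuous (Ck_partial j C1i); apply.
Qed.

End SmoothCalculus.

Arguments continuous_in {R n D F}.

Section Pullback.
Variables (R : realType) (n m : nat) (D : set 'rV[R]_n).
Let D' : set 'rV[R]_(n + m) := [set z | D (lsubmx z)].

Lemma open_pullback : open D -> open D'.
Proof.
move=> oD; apply: (@open_comp _ _ (fun z : 'rV[R]_(n + m) => lsubmx z)) => //.
by move=> z _; exact: continuous_lsubmx.
Qed.

(** The difference quotients are the same, because lsubmx is linear. *)
Lemma derivable_lsubmx (F : 'rV[R]_n -> R) (z v : 'rV[R]_(n + m)) :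
  (derivable (fun z => F (lsubmx z)) z v = derivable F (lsubmx z) (lsubmx v)) *
  ('D_v (fun z => F (lsubmx z)) z = 'D_(lsubmx v) F (lsubmx z)).
Proof.
have E : (fun h : R => h^-1 *: (F (lsubmx (h *: v + z)) - F (lsubmx z))) =
    (fun h : R => h^-1 *: (F (h *: lsubmx v + lsubmx z) - F (lsubmx z))).
  apply/funext => h.
  have -> // : lsubmx (h *: v + z) = h *: lsubmx v + lsubmx z.
  by apply/rowP => j; rewrite !mxE.
by rewrite /derivable /derive E.
Qed.

Lemma lsubmx_delta_l (i : 'I_n) :
  lsubmx (delta_mx 0 (lshift m i) : 'rV[R]_(n + m)) = delta_mx 0 i.
Proof. by apply/rowP => j; rewrite !mxE (inj_eq (@lshift_inj _ _)). Qed.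

Lemma lsubmx_delta_r (a : 'I_m) :
  lsubmx (delta_mx 0 (rshift n a) : 'rV[R]_(n + m)) = 0.
Proof. by apply/rowP => j; rewrite !mxE eq_lrshift andbF. Qed.

Lemma partial_pullback_l F i (z : 'rV[R]_(n + m)) :
  partial (lshift m i) (fun z => F (lsubmx z)) z = partial i F (lsubmx z).
Proof. by rewrite /partial derivable_lsubmx lsubmx_delta_l. Qed.

Lemma partial_pullback_r F a (z : 'rV[R]_(n + m)) :
  partial (rshift n a) (fun z => F (lsubmx z)) z = 0.
Proof. by rewrite /partial derivable_lsubmx lsubmx_delta_r derive0. Qed.

Lemma Ck_pullback k F : open D -> Ck k D F -> Ck k D' (fun z => F (lsubmx z)).
Proof.
move=> oD; have oD' := open_pullback oD.
have cP (G : 'rV[R]_n -> R) : {in D, continuous G} ->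
    {in D', continuous (fun z => G (lsubmx z))}.
  move=> /continuous_in cG; apply/continuous_in => z Dz.
  by apply: continuous_comp; [exact: continuous_lsubmx | exact: cG].
elim: k F => [|k IH] F CF.
  by split=> //; apply: cP; exact: Ck_continuous CF.
apply: Ck_intro => [|c z Dz|c].
- by apply: cP; exact: Ck_continuous CF.
- rewrite derivable_lsubmx; case: (split_ordP c) => [i|a] ->.
    by rewrite lsubmx_delta_l; exact: Ck_derivable CF _ _ Dz.
  by rewrite lsubmx_delta_r; exact: derivable0.
- case: (split_ordP c) => [i|a] ->.
    apply: Ck_ext (IH _ (Ck_partial i CF)) => // z _.
    by rewrite partial_pullback_l.
  apply: Ck_ext (Ck_cst _ _ 0) => // z _.
  by rewrite partial_pullback_r.
Qed.

End Pullback.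

(** * The ring of smooth functions on an open set *)

(** Nonemptiness makes the ring of smooth functions nontrivial. *)
Record open_domain (R : realType) (N : nat) := OpenDomain {
  dom_set :> set 'rV[R]_N;
  dom_open : open dom_set;
  dom_nonempty : exists x, dom_set x
}.

Arguments dom_open {R N} o.
Arguments dom_nonempty {R N} o.

(** The functions are extended by 0, so that equality in the ring is equality on
the domain; a derivative only depends on the germ and can be cut off in the same
way. *)
Record smfun (R : realType) (N : nat) (U : open_domain R N) := SmFun {
  sm_fun :> 'rV[R]_N -> R;
  sm_smooth : smooth_on U sm_fun;
  sm_out : forall x, ~ dom_set U x -> sm_fun x = 0
}.

HB.instance Definition _ (R : realType) N (U : open_domain R N) :=
  gen_eqMixin (smfun U).
HB.instance Definition _ (R : realType) N (U : open_domain R N) :=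
  gen_choiceMixin (smfun U).

Section SmoothRing.
Variables (R : realType) (N : nat) (U : open_domain R N).
Implicit Types a b c : smfun U.

Lemma smfun_eq a b : (forall x, dom_set U x -> a x = b x) -> a = b.
Proof.
move=> ab; have E : sm_fun a = sm_fun b.
  apply/funext => x; have [Ux|nUx] := pselect (dom_set U x); first exact: ab.
  by rewrite !sm_out.
case: a b E {ab} => [F sF oF] [G sG oG] /= E; case: G / E sG oG => sG oG.
by congr SmFun; exact: Prop_irrelevance.
Qed.

Section Restriction.
Variables (F : 'rV[R]_N -> R) (sF : smooth_on U F).

Let rF x := if x \in (U : set _) then F x else 0.

Let rF_in x : dom_set U x -> F x = rF x.
Proof. by move=> Ux; rewrite /rF mem_set. Qed.

Let rF_smooth : smooth_on U rF.
Proof. by move=> k; apply: Ck_ext (sF k); [exact: dom_open | exact: rF_in]. Qed.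

Let rF_out x : ~ dom_set U x -> rF x = 0.
Proof. by move=> Ux; rewrite /rF memNset. Qed.

Definition sm_restrict : smfun U := SmFun rF_smooth rF_out.

Lemma sm_restrictE x : dom_set U x -> sm_restrict x = F x.
Proof. by move=> Ux; rewrite /= -rF_in. Qed.

End Restriction.

Definition sm_cst (c : R) : smfun U :=
  sm_restrict (fun k => Ck_cst (dom_open U) k c).

Lemma sm_cstE (c : R) x : dom_set U x -> sm_cst c x = c.
Proof. exact: sm_restrictE. Qed.

Lemma sm_add_subproof a b : smooth_on U (fun x => a x + b x).
Proof. by move=> k; apply: Ck_add; [exact: dom_open | exact: sm_smooth..]. Qed.

Lemma sm_mul_subproof a b : smooth_on U (fun x => a x * b x).
Proof. by move=> k; apply: Ck_mul; [exact: dom_open | exact: sm_smooth..]. Qed.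

Definition sm_add a b : smfun U :=
  SmFun (sm_add_subproof a b)
    (fun x Ux => etrans (f_equal2 +%R (sm_out a Ux) (sm_out b Ux)) (addr0 0)).

Definition sm_mul a b : smfun U :=
  SmFun (sm_mul_subproof a b)
    (fun x Ux => etrans (f_equal2 *%R (sm_out a Ux) (sm_out b Ux)) (mul0r 0)).

Lemma sm_addE a b x : sm_add a b x = a x + b x. Proof. by []. Qed.
Lemma sm_mulE a b x : sm_mul a b x = a x * b x. Proof. by []. Qed.

Definition sm_opp a : smfun U := sm_mul (sm_cst (-1)) a.

Lemma sm_oppE a x : sm_opp a x = - a x.
Proof.
have [Ux|nUx] := pselect (dom_set U x); last by rewrite !sm_out // oppr0.
by rewrite sm_mulE sm_cstE // mulN1r.
Qed.

Lemma sm_addA : associative sm_add.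
Proof. by move=> a b c; apply: smfun_eq => x _ /=; rewrite addrA. Qed.
Lemma sm_addC : commutative sm_add.
Proof. by move=> a b; apply: smfun_eq => x _ /=; rewrite addrC. Qed.
Lemma sm_add0 : left_id (sm_cst 0) sm_add.
Proof.
move=> a; apply: smfun_eq => x Ux.
by rewrite sm_addE sm_cstE // add0r.
Qed.
Lemma sm_addN : left_inverse (sm_cst 0) sm_opp sm_add.
Proof.
move=> a; apply: smfun_eq => x Ux.
by rewrite sm_addE sm_oppE sm_cstE // addNr.
Qed.

HB.instance Definition _ :=
  GRing.isZmodule.Build (smfun U) sm_addA sm_addC sm_add0 sm_addN.

Lemma sm_mulA : associative sm_mul.
Proof. by move=> a b c; apply: smfun_eq => x _ /=; rewrite mulrA. Qed.
Lemma sm_mulC : commutative sm_mul.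
Proof. by move=> a b; apply: smfun_eq => x _ /=; rewrite mulrC. Qed.
Lemma sm_mul1 : left_id (sm_cst 1) sm_mul.
Proof.
move=> a; apply: smfun_eq => x Ux.
by rewrite sm_mulE sm_cstE // mul1r.
Qed.
Lemma sm_mulD : left_distributive sm_mul sm_add.
Proof. by move=> a b c; apply: smfun_eq => x _ /=; rewrite mulrDl. Qed.
Lemma sm_1neq0 : sm_cst 1 != 0 :> smfun U.
Proof.
apply/eqP => E; have [x Ux] := dom_nonempty U.
have : sm_cst 1 x = sm_cst 0 x by rewrite E.
by rewrite !sm_cstE // => /eqP; rewrite oner_eq0.
Qed.

HB.instance Definition _ :=
  GRing.Zmodule_isComNzRing.Build (smfun U)
    sm_mulA sm_mulC sm_mul1 sm_mulD sm_1neq0.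

Definition sm_partial i a : smfun U :=
  sm_restrict (fun k => Ck_partial i (sm_smooth a k.+1)).

Lemma sm_partialE i a x : dom_set U x -> sm_partial i a x = partial i a x.
Proof. exact: sm_restrictE. Qed.

Lemma sm_derivable a i x : dom_set U x -> derivable a x (delta_mx 0 i).
Proof. by move=> Ux; apply: (Ck_derivable (sm_smooth a 1%N)). Qed.

Lemma sm_partial_zmod i : zmod_morphism (sm_partial i).
Proof.
move=> a b; apply: smfun_eq => x Ux.
have da (c : smfun U) : derivable c x (delta_mx 0 i) by exact: sm_derivable.
have -> : (sm_partial i a - sm_partial i b) x =
    partial i a x - partial i b x.
  rewrite -!sm_partialE //.
  exact: etrans (sm_addE _ _ _) (congr1 (+%R _) (sm_oppE _ _)).
rewrite sm_partialE // /partial -deriveB //.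
apply: partial_ext Ux => [|y Uy]; first exact: dom_open.
exact: etrans (sm_addE _ _ _) (congr1 (+%R _) (sm_oppE _ _)).
Qed.

Lemma sm_partialM i a b :
  sm_partial i (a * b) = sm_partial i a * b + a * sm_partial i b.
Proof.
apply: smfun_eq => x Ux.
have da (c : smfun U) : derivable c x (delta_mx 0 i) by exact: sm_derivable.
have -> : (sm_partial i a * b + a * sm_partial i b) x =
    partial i a x * b x + a x * partial i b x by rewrite -!sm_partialE.
rewrite sm_partialE // addrC [partial i a x * _]mulrC.
by rewrite /partial -[_ + _](@deriveM _ _ a b).
Qed.

Definition sm_der i : derivation (smfun U) :=
  Derivation (sm_partial_zmod i) (sm_partialM i).

Lemma sm_derE i a x : dom_set U x -> sm_der i a x = partial i a x.
Proof. exact: sm_partialE. Qed.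

Lemma sm_derC i j a : sm_der i (sm_der j a) = sm_der j (sm_der i a).
Proof.
apply: smfun_eq => x Ux.
have E k l : sm_der k (sm_der l a) x = partial k (partial l a) x.
  apply: etrans (sm_derE k _ Ux) _.
  by apply: (partial_ext (dom_open U)) => // y Uy; exact: sm_derE.
apply: (etrans (E _ _)); apply: (etrans _ (esym (E _ _))).
by apply: (partialC (dom_open U)) => //; exact: sm_smooth.
Qed.

Definition sm_half : smfun U := sm_cst 2^-1.

Lemma sm_half2 : sm_half + sm_half = 1.
Proof.
apply: smfun_eq => x Ux.
have -> : (sm_half + sm_half) x = 2^-1 + 2^-1 by congr (_ + _); exact: sm_cstE.
have -> : (1 : smfun U) x = 1 by exact: sm_cstE.
by rewrite [RHS]splitr mul1r.
Qed.

Lemma sm_inverse a : (forall x, dom_set U x -> a x != 0) ->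
  exists b : smfun U, a * b = 1.
Proof.
move=> a0; have sV : smooth_on U (fun x => (a x)^-1).
  by move=> k; apply: Ck_inv => //; [exact: dom_open | exact: sm_smooth].
exists (sm_restrict sV); apply: smfun_eq => x Ux.
have -> : (1 : smfun U) x = 1 by exact: sm_cstE.
by rewrite [LHS]sm_mulE sm_restrictE // divff // a0.
Qed.

End SmoothRing.

Section Evaluation.
Variables (R : realType) (N : nat) (U : open_domain R N).
Variable p : {x | dom_set U x}.

Definition sm_eval (a : smfun U) : R := a (sval p).
Arguments sm_eval : simpl never.

Lemma sm_eval_zmod : zmod_morphism sm_eval.
Proof.
move=> a b; rewrite /sm_eval.
exact: etrans (sm_addE _ _ _) (congr1 (+%R _) (sm_oppE _ _)).
Qed.

HB.instance Definition _ :=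
  GRing.isZmodMorphism.Build (smfun U) R sm_eval sm_eval_zmod.

Lemma sm_eval_monoid : monoid_morphism sm_eval.
Proof. by split=> //; exact: (sm_cstE 1 (svalP p)). Qed.

HB.instance Definition _ :=
  GRing.isMonoidMorphism.Build (smfun U) R sm_eval sm_eval_monoid.

End Evaluation.
Arguments sm_eval : simpl never.

Section SmoothMatrix.
Variables (R : realType) (N : nat) (U : open_domain R N).

(** The adjugate over the determinant. *)
Lemma sm_mx_inverse q (A : 'M[smfun U]_q) :
  (forall p, map_mx (sm_eval p) A \in unitmx) ->
  exists Ai : 'M[smfun U]_q, A *m Ai = 1%:M.
Proof.
move=> uA; have [x Ux|di dK] := @sm_inverse R N U (\det A).
  by have := uA (exist _ x Ux); rewrite unitmxE det_map_mx unitfE.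
exists (di *: \adj A); rewrite -scalemxAr mul_mx_adj scale_scalar_mx.
by rewrite mulrC dK.
Qed.

End SmoothMatrix.

(** * Evaluating the algebraic expressions *)

Lemma partial_cst (R : realType) n (i : 'I_n) (c : R) x :
  partial i (fun=> c) x = 0.
Proof. exact: derive_cst. Qed.

(** Coordinate fields have constant components and commute. *)
Lemma riemE (R : realType) n (g : 'rV[R]_n -> 'M[R]_n) k l j s x :
  riem g k l j s x =
  partial k (christoffel g l j s) x - partial l (christoffel g k j s) x
  + \sum_m (christoffel g l j m x * christoffel g k m s x)
  - \sum_m (christoffel g k j m x * christoffel g l m s x).
Proof.
have coordE a y i : @coord_field R n a y 0 i = (i == a)%:R.
  by rewrite /coord_field mxE eqxx.
have nablaE a (Y : 'rV[R]_n -> 'rV[R]_n) y h :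
    nabla g (@coord_field R n a) Y y 0 h =
    partial a (fun z => Y z 0 h) y + \sum_j' christoffel g a j' h y * Y y 0 j'.
  rewrite mxE; under eq_bigr => i _ do rewrite coordE.
  by rewrite sum_delta.
have nabla_coord a b h :
    (fun y => nabla g (@coord_field R n a) (@coord_field R n b) y 0 h) =
    christoffel g a b h.
  apply/funext => y; rewrite nablaE partial_cst add0r.
  under eq_bigr => i _ do rewrite coordE mulrC.
  by rewrite sum_delta.
have bracket0 : bracket (@coord_field R n k) (@coord_field R n l) x = 0.
  apply/rowP => h; rewrite mxE [RHS]mxE big1 // => i _.
  by rewrite !partial_cst !mulr0 subr0.
have nabla0 (Y : 'rV[R]_n -> 'rV[R]_n) (X : 'rV[R]_n -> 'rV[R]_n) h :
    X x = 0 -> nabla g X Y x 0 h = 0.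
  by move=> X0; rewrite mxE X0 big1 // => i _; rewrite mxE mul0r.
have step a b : nabla g (@coord_field R n a)
    (nabla g (@coord_field R n b) (@coord_field R n j)) x 0 s =
    partial a (christoffel g b j s) x
    + \sum_m christoffel g b j m x * christoffel g a m s x.
  rewrite nablaE nabla_coord; congr (_ + _); apply: eq_bigr => m _.
  by rewrite mulrC -[christoffel g b j m]nabla_coord.
rewrite /riem /curvature.
have mxEs (X Y Z : 'rV[R]_n) : (X - Y - Z) 0 s = X 0 s - Y 0 s - Z 0 s.
  by rewrite !mxE.
rewrite mxEs (nabla0 _ (bracket _ _)) // !step subr0 opprD addrA; congr (_ - _).
by rewrite addrAC.
Qed.

Section Representation.
Variables (R : realType) (N p : nat) (U : open_domain R N).
Variables (prj : 'rV[R]_N -> 'rV[R]_p) (d : 'I_p -> derivation (smfun U)).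

(** The map prj is the identity for objects on the bundle, and the bundle
projection for the objects on the base that are built from g and f. *)
Definition represents (a : smfun U) (F : 'rV[R]_p -> R) :=
  forall z, dom_set U z -> a z = F (prj z).

Hypothesis represents_der : forall i a F,
  represents a F -> represents (d i a) (partial i F).

Lemma represents_add a b F G : represents a F -> represents b G ->
  represents (a + b) (fun x => F x + G x).
Proof.
move=> aF bG z Uz; apply: etrans (sm_addE _ _ _) _.
by rewrite aF // bG.
Qed.

Lemma represents_mul a b F G : represents a F -> represents b G ->
  represents (a * b) (fun x => F x * G x).
Proof.
move=> aF bG z Uz; apply: etrans (sm_mulE _ _ _) _.
by rewrite aF // bG.
Qed.

Lemma represents_opp a F : represents a F -> represents (- a) (fun x => - F x).
Proof. by move=> aF z Uz; apply: etrans (sm_oppE _ _) _; rewrite aF. Qed.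

Lemma represents_sub a b F G : represents a F -> represents b G ->
  represents (a - b) (fun x => F x - G x).
Proof. by move=> aF bG; apply: represents_add => //; exact: represents_opp. Qed.

Lemma represents_cst (c : R) : represents (sm_cst U c) (fun=> c).
Proof. by move=> z Uz; exact: sm_cstE. Qed.

Lemma represents_nat k : represents k%:R (fun=> k%:R).
Proof.
elim: k => [|k IH]; first exact: represents_cst.
rewrite -addn1 natrD.
have := represents_add IH (represents_cst 1).
by move=> H z Uz; rewrite H // natrD.
Qed.

Lemma represents_sum (I : finType) (a : I -> smfun U) F :
  (forall i, represents (a i) (F i)) ->
  represents (\sum_i a i) (fun x => \sum_i F i x).
Proof.
move=> aF z Uz.
have -> : (\sum_i a i : smfun U) z = \sum_i a i z.
  by rewrite -[LHS]/(sm_eval (exist _ z Uz) (\sum_i a i)) raddf_sum.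
by apply: eq_bigr => i _; exact: aF.
Qed.

Lemma represents_ext a F G : F =1 G -> represents a F -> represents a G.
Proof. by move=> FG aF z Uz; rewrite aF. Qed.

Variables (g : 'rV[R]_p -> 'M[R]_p) (gs gi : 'M[smfun U]_p).
Hypothesis gsE : forall i j, represents (gs i j) (fun x => g x i j).
Hypothesis gsK : gs *m gi = 1%:M.

Lemma represents_ginv i j : represents (gi i j) (fun x => ginv g x i j).
Proof.
move=> z Uz; pose q : {x | dom_set U x} := exist _ z Uz.
have gq : map_mx (sm_eval q) gs = g (prj z).
  by apply/matrixP => k l; rewrite mxE; exact: gsE.
have := congr1 (map_mx (sm_eval q)) gsK.
rewrite map_mxM gq map_mx1 => gK.
have [ug _] := mulmx1_unit gK.
suff <- : map_mx (sm_eval q) gi = ginv g (prj z) by rewrite mxE.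
by rewrite /ginv -[RHS]mulmx1 -gK mulKmx.
Qed.

Let Gam := koszul_connection d gs gi (sm_half U).

Lemma represents_christoffel i j h :
  represents (Gam i j h) (christoffel g i j h).
Proof.
rewrite mxE; apply: represents_mul; first exact: represents_cst.
apply: represents_sum => m; apply: represents_mul.
  exact: represents_ginv.
apply: represents_sub; last exact: represents_der.
by apply: represents_add; exact: represents_der.
Qed.

Let K := frame_curvature d (fun _ _ => 0) Gam.

Lemma represents_riem k l j s : represents (K k l j s) (riem g k l j s).
Proof.
rewrite /K frame_curvature0.
have -> : (map_mx (d k) (Gam l) - map_mx (d l) (Gam k) + Gam l *m Gam k
    - Gam k *m Gam l) j s = d k (Gam l j s) - d l (Gam k j s)
    + \sum_m Gam l j m * Gam k m s - \sum_m Gam k j m * Gam l m s.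
  by move: (Gam) => W; rewrite !mxE.
apply: (@represents_ext _ _ _ (fun x => esym (riemE g k l j s x))).
apply: represents_sub; [apply: represents_add; [apply: represents_sub|]|].
- exact/represents_der/represents_christoffel.
- exact/represents_der/represents_christoffel.
- by apply: represents_sum => m; apply: represents_mul;
    exact: represents_christoffel.
- by apply: represents_sum => m; apply: represents_mul;
    exact: represents_christoffel.
Qed.

Lemma represents_scalar :
  represents (frame_scalar gi K) (scalar_curvature g).
Proof.
apply: represents_sum => l; apply: represents_sum => j.
apply: represents_mul; first exact: represents_ginv.
by apply: represents_sum => r; exact: represents_riem.
Qed.

Section Conformal.
Variables (f : 'rV[R]_p -> R) (fs fi : smfun U).
Hypothesis fsE : represents fs f.
Hypothesis fsK : fs * fi = 1.

Lemma represents_inv : represents fi (fun x => (f x)^-1).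
Proof.
move=> z Uz; have : fs z * fi z = 1.
  by rewrite -(sm_mulE fs fi z); have := represents_nat 1 Uz; rewrite -fsK.
rewrite (fsE Uz) => ffi; rewrite -[RHS]mulr1 -ffi mulKf //.
by apply/eqP => f0; move: ffi; rewrite f0 mul0r => /esym/eqP; rewrite oner_eq0.
Qed.

Let S := conformal_shift d gs gi (sm_half U) fs fi.

Lemma represents_half_fA j i h : represents (S j i h) (half_fA g f j i h).
Proof.
rewrite mxE; apply: (@represents_ext _ (fun x => 2^-1 * (f x)^-1 *
   fA g f j i h x)) => [x|]; first by rewrite /half_fA invfM.
apply: represents_mul.
  by apply: represents_mul; [exact: represents_cst | exact: represents_inv].
apply: represents_sub.
  by apply: represents_add; apply: represents_mul;
    (exact: represents_nat || exact: represents_der).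
apply: represents_mul; last exact: gsE.
apply: represents_sum => m; apply: represents_mul; first exact: represents_ginv.
exact: represents_der.
Qed.

Lemma represents_cov12 r l j h :
  represents (cov_shift d gs gi Gam (sm_half U) fs fi r l j h)
             (cov12 g (half_fA g f) r l j h).
Proof.
apply: represents_add; first exact/represents_der/represents_half_fA.
apply: represents_sum => s; apply: represents_sub; first apply: represents_sub.
all: by apply: represents_mul;
  (exact: represents_christoffel || exact: represents_half_fA).
Qed.

Lemma represents_fL : represents
  (fi * \sum_l \sum_j gi l j *
    (\sum_r cov_shift d gs gi Gam (sm_half U) fs fi r l j r
     - \sum_r cov_shift d gs gi Gam (sm_half U) fs fi l r j r
     + \sum_r \sum_s S r s r * S l j s - \sum_r \sum_s S l s r * S r j s))
  (fL g f).
Proof.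
apply: (@represents_ext _ (fun x => (f x)^-1 * \sum_l \sum_j ginv g x l j *
  (\sum_r cov12 g (half_fA g f) r l j r x
   - \sum_r cov12 g (half_fA g f) l r j r x
   + \sum_r \sum_s half_fA g f r s r x * half_fA g f l j s x
   - \sum_r \sum_s half_fA g f l s r x * half_fA g f r j s x))) => [x|].
  have half2 (F G : 'I_p -> 'I_p -> 'rV[R]_p -> R) :
      \sum_r \sum_s ((2 * f x)^-1 * F r s x) * ((2 * f x)^-1 * G r s x) =
      (4 * f x ^+ 2)^-1 * \sum_r \sum_s F r s x * G r s x.
    rewrite mulr_sumr; apply: eq_bigr => r _; rewrite mulr_sumr.
    apply: eq_bigr => s _.
    have -> : 4 * f x ^+ 2 = (2 * f x) * (2 * f x) by ring.
    by move: (2 * f x) => c; rewrite invfM; ring.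
  rewrite /fL; congr (_ * _); apply: eq_bigr => l _; apply: eq_bigr => j _.
  congr (_ * (_ + _ - _)).
    exact: (half2 (fun r s => fA g f r s r) (fun r s => fA g f l j s)).
  exact: (half2 (fun r s => fA g f l s r) (fun r s => fA g f r j s)).
apply: represents_mul; first exact: represents_inv.
apply: represents_sum => l; apply: represents_sum => j.
apply: represents_mul; first exact: represents_ginv.
apply: represents_sub; [apply: represents_add; [apply: represents_sub|]|].
- by apply: represents_sum => r; exact: represents_cov12.
- by apply: represents_sum => r; exact: represents_cov12.
- by apply: represents_sum => r; apply: represents_sum => s;
    apply: represents_mul; exact: represents_half_fA.
- by apply: represents_sum => r; apply: represents_sum => s;
    apply: represents_mul; exact: represents_half_fA.
Qed.

End Conformal.

End Representation.

(** * The rescaled Sasaki metric in an induced chart *)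

Lemma posdef_unitmx (R : realType) n (A : 'M[R]_n) :
  (forall X : 'rV[R]_n, X != 0 -> 0 < (X *m A *m X^T) 0 0) -> A \in unitmx.
Proof.
move=> A_pos; rewrite -row_free_unit -kermx_eq0; apply: contraT => /rowV0Pn[X].
by move=> /sub_kermxP XA /A_pos; rewrite XA mul0mx mxE ltxx.
Qed.

Lemma bilin_row (R : realType) p q (E : 'M[R]_(p, q)) (B : 'M[R]_q) a b :
  (E *m B *m E^T) a b = bilin B (row a E) (row b E).
Proof.
rewrite /bilin -row_mul mxE [RHS]mxE; apply: eq_bigr => k _.
by rewrite [row _ _ _ _]mxE [E^T _ _]mxE [(row b E)^T _ _]mxE [row b E _ _]mxE.
Qed.

Section Assembly.
Variables (R : realType) (n : nat) (M : smoothManifold R n).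
Variables (g : riemannianMetric M) (f : M -> R).
Hypotheses (f_smooth : smooth_function f) (f_gt0 : forall p : M, 0 < f p).
Variable u : chart M.
Variable z0 : 'rV[R]_(n + n * n).
Hypothesis z0P : chart_img u (lsubmx z0).

Let D : set 'rV[R]_n := @chart_img R n M u.

Let oD : open D. Proof. exact: open_chart_img. Qed.

Definition bundle_domain : open_domain R (n + n * n) :=
  OpenDomain (open_pullback (m := (n * n)%N) oD) (ex_intro _ z0 z0P).
Let U := bundle_domain.
Let B := smfun U.

Definition pulled F (sF : smooth_on D F) : smfun U :=
  @sm_restrict _ _ U (fun z => F (lsubmx z))
    (fun k => Ck_pullback _ oD (sF k)).

Let rep := represents (U := U) (fun z => lsubmx z).

Lemma pulledE F (sF : smooth_on D F) : rep (pulled sF) F.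
Proof. by move=> z Uz; exact: sm_restrictE. Qed.

Let d (c : 'I_(n + n * n)) : derivation B := sm_der U c.
Let dh i := d (lshift (n * n) i).
Let dv a := d (rshift n a).

Let rep_dh i a F : rep a F -> rep (dh i a) (partial i F).
Proof.
move=> aF z Uz; apply: etrans (sm_derE _ _ Uz) _.
rewrite -partial_pullback_l.
by apply: (partial_ext (dom_open U)).
Qed.

Let rep_dv c a F : rep a F -> dv c a = 0.
Proof.
move=> aF; apply: smfun_eq => z Uz; apply: etrans (sm_derE _ _ Uz) _.
transitivity (partial (rshift n c) (fun z => F (lsubmx z)) z).
  by apply: (partial_ext (dom_open U)).
by rewrite partial_pullback_r; apply: esym; exact: (sm_cstE 0 Uz).
Qed.

Let rep_id c a (F : 'rV[R]_(n + n * n) -> R) : represents (U := U) id a F ->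
  represents (U := U) id (d c a) (partial c F).
Proof.
move=> aF z Uz; apply: etrans (sm_derE _ _ Uz) _.
by apply: (partial_ext (dom_open U)).
Qed.

Definition pulled_metric : 'M[smfun U]_n :=
  \matrix_(i, j) pulled (metric_comp_smooth g u i j).
Let gs := pulled_metric.

Definition pulled_factor : smfun U := pulled (f_smooth u).
Let fs := pulled_factor.

Let gsE i j : rep (gs i j) (fun x => g u x i j).
Proof. by rewrite mxE; exact: pulledE. Qed.

Let fsE : rep fs (local_rep u f).
Proof. exact: pulledE. Qed.

Let ev_gs (q : {z | dom_set U z}) :
  map_mx (sm_eval q) gs = g u (lsubmx (sval q)).
Proof.
by apply/matrixP => i j; rewrite mxE; apply: gsE; exact: svalP.
Qed.

Let gsT : gs^T = gs.
Proof.
apply/matrixP => i j; rewrite [LHS]mxE; apply: smfun_eq => z Uz.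
rewrite (gsE j i Uz) (gsE i j Uz).
by rewrite -[in LHS](metric_comp_sym g Uz) mxE.
Qed.

Lemma pulled_metric_inverse : exists gi, gs *m gi = 1%:M.
Proof.
apply: sm_mx_inverse => q; rewrite ev_gs.
by apply: posdef_unitmx; apply: metric_comp_pos; exact: (svalP q).
Qed.

Lemma pulled_factor_inverse : exists fi, fs * fi = 1.
Proof.
apply: sm_inverse => z Uz; rewrite (fsE Uz).
by rewrite gt_eqF // /local_rep.
Qed.

Definition fibre_coord : 'M[smfun U]_n := \matrix_(i, j)
  @sm_restrict _ _ U _
    (fun k => Ck_coord (dom_open U) k (rshift n (mxvec_index i j))).
Let t := fibre_coord.

Let tE i j z : dom_set U z -> t i j z = z 0 (rshift n (mxvec_index i j)).
Proof. by move=> Uz; rewrite mxE; exact: sm_restrictE. Qed.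

Let d_t c i j : d c (t i j) = (c == rshift n (mxvec_index i j))%:R.
Proof.
apply: smfun_eq => z Uz; apply: etrans (sm_derE _ _ Uz) _.
transitivity (partial c (fun z : 'rV[R]_(n + n * n) =>
    z 0 (rshift n (mxvec_index i j))) z).
  by apply: (partial_ext (dom_open U)) => // y Uy; exact: tE.
rewrite /partial.
case: (derive_coord (rshift n (mxvec_index i j)) z (delta_mx 0 c)) => _ ->.
rewrite mxE eqxx eq_sym.
by exact/esym/(represents_nat (U := U) id _ Uz).
Qed.

Let dh_t s i j : dh s (t i j) = 0.
Proof. by rewrite d_t eq_lrshift. Qed.

Let dv_t k l i j :
  dv (mxvec_index k l) (t i j) = ((i == k) && (j == l))%:R.
Proof.
rewrite d_t (inj_eq (@rshift_inj _ _)).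
have /matrixP/(_ i j) := vec_mx_delta B k l.
by rewrite [LHS]mxE [LHS]mxE [RHS]mxE eqxx eq_sym => ->.
Qed.

Let half := sm_half U.

Section WithInverses.
Variables (gi : 'M[smfun U]_n) (fi : smfun U).
Hypotheses (gsK : gs *m gi = 1%:M) (fsK : fs * fi = 1).

Let Gam := koszul_connection dh gs gi half.

Let GamP : levi_civita dh (fun _ _ => 0) gs Gam.
Proof. exact: koszul_levi_civita gsK gsT (sm_half2 U). Qed.

Let GamE i j h : rep (Gam i j h) (christoffel (g u) i j h).
Proof. exact: represents_christoffel. Qed.

Let dv_gs a : map_mx (dv a) gs = 0.
Proof. by apply/matrixP => i j; rewrite mxE (rep_dv _ (gsE i j)) mxE. Qed.

Let dv_Gam a i : map_mx (dv a) (Gam i) = 0.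
Proof.
by apply/matrixP => j h; rewrite [LHS]mxE (rep_dv _ (GamE i j h)) mxE.
Qed.

Let dv_fs a : dv a fs = 0.
Proof. exact: rep_dv fsE. Qed.

Let H := lift_mx Gam t.
Let E := hor_frame H.
Let Ei := hor_coframe H.
Let h := tensor_mx gs gi.

(** The metric reconstructed from its blocks in the adapted frame. Its entries
belong to the ring by construction, and so does the given metric G once it is
shown to coincide with it. *)
Definition sasaki_mx : 'M[smfun U]_(n + n * n) :=
  Ei *m block_mx (fs *: gs) 0 0 h *m Ei^T.
Let Gs := sasaki_mx.

Let Gi := E^T *m block_mx (fi *: gi) 0 0 (tensor_mx gi gs) *m E.

Let EEi : E *m Ei = 1%:M. Proof. exact: hor_frameK. Qed.
Let EiE : Ei *m E = 1%:M. Proof. exact: hor_coframeK. Qed.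

Let EG : E *m Gs *m E^T = block_mx (fs *: gs) 0 0 h.
Proof. exact: congruenceK. Qed.

Let GsK : Gs *m Gi = 1%:M.
Proof.
apply: (congruence_inv EEi EiE).
rewrite mulmx_block !mulmx0 !mul0mx !addr0 !add0r.
rewrite -scalemxAl -scalemxAr scalerA fsK scale1r gsK.
by rewrite tensor_mxM gsK (mulmx1C gsK) tensor_mx1 -scalar_mx_block.
Qed.

Let giT : gi^T = gi.
Proof. exact: sym_inverse gsK gsT. Qed.

Let GsT : Gs^T = Gs.
Proof.
apply: congruence_sym; rewrite tr_block_mx !trmx0.
by rewrite linearZ /= gsT tensor_mxT gsT giT.
Qed.

Variable G : chart M -> 'rV[R]_(n + n * n) -> 'M[R]_(n + n * n).
Hypothesis G_sasaki : rescaled_sasaki g f G.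

(** The rows of the adapted frame are the horizontal lifts of the coordinate
fields and the vertical lifts of the matrix units; so the defining conditions of
G are the entries of E *m G *m E^T. *)
Let GsE i j : represents (U := U) id (Gs i j) (fun z => G u z i j).
Proof.
move=> z Uz; pose q : {z | dom_set U z} := exist _ z Uz.
pose ev := sm_eval q.
pose x := lsubmx z; pose tz := vec_mx (rsubmx z) : 'M[R]_n.
have zE : z = bundle_coords x tz.
  by rewrite /bundle_coords /x /tz vec_mxK hsubmxK.
have Hrow i' : row i' (map_mx ev H) =
    rsubmx (hlift (g u) x tz (delta_mx 0 i')).
  rewrite /hlift row_mxKr; apply/rowP => b; case/mxvec_indexP: b => k l.
  rewrite [LHS]mxE [LHS]mxE (lift_mxE Gam t) mxvecE [RHS]mxE.
  have deltaE s : (delta_mx 0 i' : 'rV[R]_n) 0 s = (s == i')%:R.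
    by rewrite mxE eqxx.
  under [RHS]eq_bigr => s _ do rewrite deltaE.
  rewrite sum_delta /tensor_lift.
  have -> : (t *m (Gam i')^T - (Gam i')^T *m t) k l =
      \sum_m (t k m * Gam i' l m - Gam i' m k * t m l).
    rewrite sumrB !mxE; congr (_ - _); apply: eq_bigr => m _;
    by rewrite [(Gam i')^T _ _]mxE.
  rewrite /ev raddf_sum /=; apply: eq_bigr => m _.
  rewrite rmorphB !rmorphM /=.
  have evt a b : ev (t a b) = tz a b by rewrite /ev /sm_eval tE // !mxE.
  have evG a b c : ev (Gam a b c) = christoffel (g u) a b c x by exact: GamE.
  by rewrite -/ev !evt !evG [X in X - _]mulrC.
have Erow_l i' : row (lshift _ i') (map_mx ev E) =
    hlift (g u) x tz (delta_mx 0 i').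
  rewrite /E /hor_frame map_block_mx block_mxEv -row_usubmx col_mxKu row_row_mx.
  rewrite Hrow map_mx1 row1.
  by rewrite /hlift row_mxKr.
have Erow_r k l : row (rshift _ (mxvec_index k l)) (map_mx ev E) =
    vlift (delta_mx k l).
  rewrite /E /hor_frame map_block_mx block_mxEv -row_dsubmx col_mxKd row_row_mx.
  by rewrite map_mx1 map_mx0 row1 row0 /vlift mxvec_delta.
have [GT Gl] := G_sasaki tz Uz; rewrite -/x -zE in GT Gl.
have scst p q' (A : 'M[R]_(p, q')) : smooth_mx_on D (fun=> A).
  by move=> i' j' k; exact: Ck_cst.
have GS v w : bilin (G u z) v w = bilin (G u z) w v.
  rewrite /bilin; have -> : w *m G u z *m v^T = (v *m G u z *m w^T)^T.
    by rewrite !trmx_mul trmxK GT mulmxA.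
  by rewrite [RHS]mxE.
have EGE : map_mx ev E *m G u z *m (map_mx ev E)^T =
    map_mx ev (block_mx (fs *: gs) 0 0 h).
  apply/matrixP => a b; rewrite bilin_row [in RHS]map_block_mx !map_mx0.
  case: (split_ordP a) => [i'|a'] ->; case: (split_ordP b) => [j'|b'] ->.
  - rewrite !Erow_l block_mxEul.
    have [_ _ ->] := Gl 0 0 _ _ (scst _ _ 0) (scst _ _ 0)
      (scst _ _ (delta_mx 0 i')) (scst _ _ (delta_mx 0 j')).
    rewrite [RHS]mxE [(fs *: gs) _ _]mxE /ev rmorphM /=; congr (_ * _).
      by rewrite /ev /sm_eval (fsE Uz).
    rewrite /ev /sm_eval (gsE i' j' Uz) /bilin -rowE trmx_delta -colE.
    by rewrite [LHS]mxE [LHS]mxE.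
  - rewrite block_mxEur [RHS]mxE; case/mxvec_indexP: b' => k l.
    rewrite Erow_l Erow_r GS.
    by have [_ -> _] := Gl (fun=> delta_mx k l) 0 0 _ (scst _ _ _) (scst _ _ 0)
      (scst _ _ 0) (scst _ _ (delta_mx 0 i')).
  - rewrite block_mxEdl [RHS]mxE; case/mxvec_indexP: a' => k l.
    rewrite Erow_l Erow_r.
    by have [_ -> _] := Gl (fun=> delta_mx k l) 0 0 _ (scst _ _ _) (scst _ _ 0)
      (scst _ _ 0) (scst _ _ (delta_mx 0 j')).
  - rewrite block_mxEdr [RHS]mxE; case/mxvec_indexP: a' => k l.
    case/mxvec_indexP: b' => k' l'; rewrite !Erow_r.
    have [-> _ _] := Gl (fun=> delta_mx k l) (fun=> delta_mx k' l') 0 0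
      (scst _ _ _) (scst _ _ _) (scst _ _ 0) (scst _ _ 0).
    rewrite tensor_mxE /ev rmorphM /= -/ev.
    have -> : ev (gs k k') = g u x k k' by exact: gsE.
    have -> : ev (gi l l') = ginv (g u) x l l'.
      exact: (represents_ginv (prj := fun z => lsubmx z) gsE gsK).
    rewrite (bigD1 k) //= [X in _ + X]big1 ?addr0; last first.
      move=> m /negPf mk; do 3 (apply: big1 => ? _).
      by rewrite mxE mk /= mulr0 mul0r.
    rewrite (bigD1 k') //= [X in _ + X]big1 ?addr0; last first.
      move=> m /negPf mk; do 2 (apply: big1 => ? _).
      by rewrite [delta_mx k' _ _ _]mxE mk /= mulr0.
    rewrite (bigD1 l) //= [X in _ + X]big1 ?addr0; last first.
      move=> m /negPf mk; apply: big1 => ? _.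
      by rewrite mxE mk andbF mulr0 mul0r.
    rewrite (bigD1 l') //= [X in _ + X]big1 ?addr0; last first.
      by move=> m /negPf mk; rewrite [delta_mx k' _ _ _]mxE mk andbF mulr0.
    by rewrite !mxE !eqxx !mulr1.
have EiK : map_mx ev Ei *m map_mx ev E = 1%:M.
  by rewrite -map_mxM EiE map_mx1.
have EK : map_mx ev E *m map_mx ev Ei = 1%:M.
  by rewrite -map_mxM EEi map_mx1.
suff -> : G u z = map_mx ev Gs by rewrite [RHS]mxE.
have GsEv : map_mx ev Gs = map_mx ev Ei *m map_mx ev (block_mx (fs *: gs) 0 0 h)
    *m (map_mx ev Ei)^T.
  by rewrite 2!map_mxM map_trmx.
rewrite GsEv -EGE; apply: esym.
exact: congruenceK EiK _.
Qed.

Let W := koszul_connection d Gs Gi half.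

Let LW : levi_civita d (fun _ _ => 0) Gs W.
Proof. exact: koszul_levi_civita GsK GsT (sm_half2 U). Qed.

Let dC i j a : d i (d j a) = d j (d i a).
Proof. exact: sm_derC. Qed.

Let S := conformal_shift dh gs gi half fs fi.

Let fLs : smfun U := fi * \sum_l \sum_j gi l j *
    (\sum_r cov_shift dh gs gi Gam half fs fi r l j r
     - \sum_r cov_shift dh gs gi Gam half fs fi l r j r
     + \sum_r \sum_s S r s r * S l j s
     - \sum_r \sum_s S l s r * S r j s).

Let Ks := frame_curvature dh (fun _ _ => 0) Gam.
Let Os i j := curvature_action t (Ks i j).

Let scalarE : frame_scalar Gi (frame_curvature d (fun _ _ => 0) W) =
  fi * frame_scalar gi Ks + fLs
   - half * half * (fi * fi * tensor_contraction gs gi Os Os).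
Proof.
exact: (tensor_bundle_scalar dC gsK gsT (sm_half2 U) fsK GamP
  dv_gs dv_Gam dv_fs dh_t dv_t GsK EG LW).
Qed.

Let two_reg (a : smfun U) : a + a = 0 -> a = 0.
Proof. exact: half_reg (sm_half2 U). Qed.

Let squareE : tensor_contraction gs gi Os Os =
  (\sum_a \sum_b \sum_h \sum_k \sum_l \sum_j \sum_v \sum_r \sum_s \sum_p
    gi a b * gi h k * gi l j * gi v r * (Ks s l *m gs) h v
      * (Ks p j *m gs) k r * t s a * t p b)
  + (\sum_c \sum_d \sum_l \sum_j \sum_h \sum_k \sum_r \sum_v \sum_s \sum_p
    gs c d * gi l j * gi h k * gi r v * Ks r l h s * Ks v j k p * t c s * t d p)
  - 2%:R * (\sum_c \sum_p \sum_r \sum_h \sum_b \sum_s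
    Ks c p r h * (\sum_e \sum_z gi r e * gi b z * Ks h e z s)
      * t c s * t p b).
Proof.
apply: (curvature_action_square t gsK gsT) => k l j m.
  by rewrite /Ks riemann_anti12 mulNmx mxE.
have dhC i i' a : dh i (dh i' a) = dh i' (dh i a) by exact: dC.
exact: (riemann_pair dhC gsT GamP two_reg).
Qed.

Let x := lsubmx z0.
Let tm : 'M[R]_n := vec_mx (rsubmx z0).
Let fx := local_rep u f x.
Let gd i j := g u x i j.
Let gu i j := ginv (g u) x i j.
Let Rm k l j s := riem (g u) k l j s x.
Let Rlow k l j m := riem_low (g u) k l j m x.
Let Rup h r b s := riem_up (g u) h r b s x.

Let T1 := \sum_a \sum_b \sum_h \sum_k \sum_l \sum_j \sum_v \sum_r \sum_s \sum_p
         gu a b * gu h k * gu l j * gu v r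
         * Rlow s l h v * Rlow p j k r * tm s a * tm p b.
Let T2 := \sum_c \sum_d \sum_l \sum_j \sum_h \sum_k \sum_r \sum_v \sum_s \sum_p
         gd c d * gu l j * gu h k * gu r v
         * Rm r l h s * Rm v j k p * tm c s * tm d p.
Let T3 := \sum_c \sum_p \sum_r \sum_h \sum_b \sum_s
         Rm c p r h * Rup h r b s * tm c s * tm p b.

Local Notation ev := (@sm_eval R _ U (exist (dom_set U) z0 z0P)).

Let ev_gi i j : ev (gi i j) = gu i j.
Proof. exact: (represents_ginv (prj := fun z => lsubmx z) gsE gsK). Qed.

Let ev_g i j : ev (gs i j) = gd i j.
Proof. exact: gsE. Qed.

Let ev_t i j : ev (t i j) = tm i j.
Proof. by rewrite /sm_eval tE // !mxE. Qed.

Let ev_Ks k l j s : ev (Ks k l j s) = Rm k l j s.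
Proof. exact: (represents_riem rep_dh gsE gsK). Qed.

Let ev_low k l j m : ev ((Ks k l *m gs) j m) = Rlow k l j m.
Proof.
rewrite mxE rmorph_sum; apply: eq_bigr => s _; rewrite rmorphM /= mulrC.
rewrite -[gs]gsT [gs^T _ _]mxE; congr (_ * _); [exact: ev_g | exact: ev_Ks].
Qed.

Let ev_square : ev (tensor_contraction gs gi Os Os) = T1 + T2 - 2 * T3.
Proof.
rewrite squareE rmorphB rmorphD rmorphM rmorph_nat /=.
congr (_ + _ - _ * _).
- do 10 (rewrite rmorph_sum; apply: eq_bigr => ? _).
  by rewrite !rmorphM /= !ev_gi !ev_low !ev_t.
- do 10 (rewrite rmorph_sum; apply: eq_bigr => ? _).
  by rewrite !rmorphM /= !ev_gi !ev_g !ev_Ks !ev_t.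
- do 6 (rewrite rmorph_sum; apply: eq_bigr => ? _).
  rewrite !rmorphM /= !ev_Ks !ev_t; congr (_ * _ * _ * _).
  do 2 (rewrite rmorph_sum; apply: eq_bigr => ? _).
  by rewrite !rmorphM /= !ev_gi !ev_Ks.
Qed.

Lemma sasaki_scalar : scalar_curvature (G u) z0 =
  fx^-1 * scalar_curvature (g u) x - (4 * fx ^+ 2)^-1 * T1
  - (4 * fx ^+ 2)^-1 * T2 + (2 * fx ^+ 2)^-1 * T3 + fL (g u) (local_rep u f) x.
Proof.
have <- : ev (frame_scalar Gi (frame_curvature d (fun _ _ => 0) W)) =
    scalar_curvature (G u) z0.
  exact: (represents_scalar (U := U) rep_id GsE GsK z0P).
have ev_fi : ev fi = fx^-1 by exact: (represents_inv fsE fsK).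
have ev_scal : ev (frame_scalar gi Ks) = scalar_curvature (g u) x.
  exact: (represents_scalar rep_dh gsE gsK).
have ev_fL : ev fLs = fL (g u) (local_rep u f) x.
  exact: (represents_fL rep_dh gsE gsK fsE fsK).
have ev_half : ev half = 2^-1 by exact: sm_cstE.
rewrite scalarE rmorphB rmorphD /= ev_fL !rmorphM /= ev_fi ev_scal.
rewrite ev_half ev_square.
have fx0 : fx != 0 by rewrite gt_eqF // /fx /local_rep.
by field.
Qed.

End WithInverses.

End Assembly.

Unset Implicit Arguments.

Theorem theorem8 (R : realType) (n : nat) (M : smoothManifold R n)
    (g : riemannianMetric M) (f : M -> R)
    (f_smooth : smooth_function f) (f_gt0 : forall p : M, 0 < f p)
    (G : chart M -> 'rV[R]_(n + n * n) -> 'M[R]_(n + n * n))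
    (G_sasaki : rescaled_sasaki g f G)
    (e : tensor11 M) (u : chart M) (eu : chart_dom u (tbase e)) :
  let x := coords u (tbase e) in
  let t (j i : 'I_n) := tcomp e u i j in
  let fx := f (tbase e) in
  let gd i j := g u x i j in
  let gu i j := ginv (g u) x i j in
  let Rm k l j s := riem (g u) k l j s x in
  let Rlow k l j m := riem_low (g u) k l j m x in
  let Rup h r b s := riem_up (g u) h r b s x in
  scalar_curvature (G u) (tensor_coords u e) =
    fx^-1 * scalar_curvature (g u) x
    - (4 * fx ^+ 2)^-1 *
      (\sum_a \sum_b \sum_h \sum_k \sum_l \sum_j \sum_v \sum_r \sum_s \sum_p
         gu a b * gu h k * gu l j * gu v r
         * Rlow s l h v * Rlow p j k r * t a s * t b p)
    - (4 * fx ^+ 2)^-1 *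
      (\sum_c \sum_d \sum_l \sum_j \sum_h \sum_k \sum_r \sum_v \sum_s \sum_p
         gd c d * gu l j * gu h k * gu r v
         * Rm r l h s * Rm v j k p * t s c * t p d)
    + (2 * fx ^+ 2)^-1 *
      (\sum_c \sum_p \sum_r \sum_h \sum_b \sum_s
         Rm c p r h * Rup h r b s * t s c * t b p)
    + fL (g u) (local_rep u f) x.
Proof.
have lE : lsubmx (tensor_coords u e) = coords u (tbase e).
  exact: row_mxKl.
have tE : vec_mx (rsubmx (tensor_coords u e)) = tcomp e u.
  by rewrite row_mxKr mxvecK.
have fE : local_rep u f (coords u (tbase e)) = f (tbase e).
  by rewrite /local_rep coordsK.
have uP : chart_img u (lsubmx (tensor_coords u e)).
  by rewrite lE; exists (tbase e).
have [gi giP] := pulled_metric_inverse g uP.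
have [fi fiP] := pulled_factor_inverse f_smooth f_gt0 uP.
have := sasaki_scalar f_gt0 giP fiP G_sasaki.
by cbv zeta; rewrite lE tE fE.
Qed.
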